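(* For every total, polynomial-time computable, polynomially bounded function $k(\cdot)$ and every integer $h\ge1$, there exists an oracle $\mathcal{A}$ such that $R^{p}_{(k(n)+1)\text{-}dtt}(\mathrm{UP}_{\le h}^{\mathcal{A}})\not\subseteq R^{p,\mathcal{A}}_{k(n)\text{-}T}(\mathrm{U}\Sigma^{p,\mathcal{A}}_h)$, and hence $R^{p}_{(k(n)+1)\text{-}dtt}(\mathrm{U}\Sigma^{p,\mathcal{A}}_h)\not\subseteq R^{p,\mathcal{A}}_{k(n)\text{-}T}(\mathrm{U}\Sigma^{p,\mathcal{A}}_h)$.
   Context: Alphabet $\{0,1\}$; $n$ denotes input length. $\mathrm{UP}_{\le h}^{A}$ is the class of sets accepted by a nondeterministic polynomial-time oracle Turing machine with oracle $A$ having at most $h$ accepting paths on every input. A $\Sigma_j(A)$-system $[A;N_1,\dots,N_j]$ consists of $A$ and nondeterministic polynomial-time oracle Turing machines; its language is $L[A;N_1]=L(N_1^A)$ and $L[A;N_1,\dots,N_j]=L(N_1^{L[A;N_2,\dots,N_j]})$; its computation on $x$ is that of $N_1$ on $x$ with oracle $A$ ($j=1$) or $L[A;N_2,\dots,N_j]$ ($j>1$); it is unambiguous if for every $1\le i\le j$ and every input $y$, $[A;N_i,\dots,N_j](y)$ has at most one accepting path. $\mathrm{U}\Sigma^{p,A}_j$ ($j\ge1$) is the class of languages of unambiguous $\Sigma_j(A)$-systems. For a class $\mathcal{C}$: $R^p_{(k(n)+1)\text{-}dtt}(\mathcal{C})$ is the class of sets $L$ for which there are $D\in\mathcal{C}$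 and a polynomial-time computable function mapping each $x$ to a list of at most $k(|x|)+1$ strings such that $x\in L$ iff at least one listed string is in $D$; $R^{p,A}_{k(n)\text{-}T}(\mathcal{C})$ is the class of sets $L$ for which there are $D\in\mathcal{C}$ and a deterministic polynomial-time oracle Turing machine $M$ with access to both $A$ and $D$ that, on every input $x$, asks at most $k(|x|)$ (adaptive) queries to $D$ (and any number to $A$) and accepts exactly the inputs in $L$. *)

(* Defs.v *)
From HB Require Import structures.
From mathcomp Require Import all_boot.
From mathcomp Require Import boolp classical_sets.

Set Implicit Arguments.
Unset Strict Implicit.
Unset Printing Implicit Defensive.

Local Open Scope classical_set_scope.

Definition word := seq bool.
Definition language := set word.

(** Nondeterministic multi-tape oracle Turing machines.  [I] indexes the
    oracles: [void] for a plain machine, [unit] for one oracle, [bool] for two.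
    Every tape is one-way infinite.  A cell is blank ([None]), an input bit
    ([Some (inl b)]) or one of the machine's own symbols ([Some (inr a)]).
    [delta q s] is the set of transitions available in state [q] when the heads
    scan [s]; a transition gives the next state and, for each tape, the symbol
    to write and the head move ([Some false]: left, [Some true]: right,
    [None]: stay).  If [query q = Some i], then [q] is a query state for oracle
    [i]: the machine ignores [delta] and passes to [answer q b], where [b] is
    the oracle's answer on the word written on [query_tape i]. *)
Record otm (I : finType) := OTM {
  state : finType;
  symbol : finType;
  tape : finType;
  start : state;
  accepting : pred state;
  in_tape : tape;
  out_tape : tape;
  query_tape : I -> tape;
  query : state -> option I;
  answer : state -> bool -> state;
  delta : state -> {ffun tape -> option (bool + symbol)} ->
    {set state * {ffun tape -> option (bool + symbol) * option bool}}
}.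

Section Computation.
Context {I : finType} (M : otm I).

Definition cell : Type := option (bool + symbol M).

(* Cells beyond the end of the sequence are blank; the number is the position
   of the head, cell 0 being the leftmost one. *)
Definition tape_content : Type := (seq cell * nat)%type.
Definition config : Type := (state M * {ffun tape M -> tape_content})%type.

Definition init (x : word) : config :=
  (start M, [ffun t => (if t == in_tape M then [seq Some (inl b) | b <- x]
                        else [::], 0)]).

Definition scan (c : config) : {ffun tape M -> cell} :=
  [ffun t => nth None (c.2 t).1 (c.2 t).2].

(* A left move at the leftmost cell leaves the head where it is. *)
Definition act (w : cell * option bool) (tc : tape_content) : tape_content :=
  (set_nth None tc.1 tc.2 w.1,
   match w.2 with
   | Some true => tc.2.+1
   | Some false => tc.2.-1
   | None => tc.2
   end).

(* The word on a tape extends from the leftmost cell up to the first cell that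
   does not contain a bit. *)
Fixpoint bits_of (s : seq cell) : word :=
  if s is Some (inl b) :: s' then b :: bits_of s' else [::].

Definition tape_word (c : config) (t : tape M) : word := bits_of (c.2 t).1.

Definition step (O : I -> language) (c c' : config) : bool :=
  match query c.1 with
  | Some i =>
      c' == (answer c.1 (tape_word c (query_tape M i) \in O i), c.2)
  | None =>
      [exists a in delta c.1 (scan c),
         c' == (a.1, [ffun t => act (a.2 t) (c.2 t)])]
  end.

Definition halted (c : config) : bool :=
  (query c.1 == None) && (#|delta c.1 (scan c)| == 0).

(* [p] lists the configurations that follow [init x] on a path. *)
Definition computation (O : I -> language) (x : word) (p : seq config) : bool :=
  path (step O) (init x) p.

Definition accepting_path (O : I -> language) (x : word) (p : seq config) :
    bool :=
  [&& computation O x p, halted (last (init x) p)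
    & accepting (last (init x) p).1].

Definition accepted (O : I -> language) : language :=
  [set x | exists p, accepting_path O x p].

Definition at_most_accepting_paths (h : nat) (O : I -> language) (x : word) :
    Prop :=
  forall ps : seq (seq config),
    uniq ps -> all (accepting_path O x) ps -> size ps <= h.

(* As usual for oracle machines, the time bound does not depend on the
   oracles. *)
Definition polytime : Prop :=
  exists e : nat, forall (O : I -> language) (x : word) (p : seq config),
    computation O x p -> size p <= size x ^ e + e.

Definition deterministic : Prop :=
  forall (q : state M) s, #|delta q s| <= 1.

Definition queries (i : I) (x : word) (p : seq config) : nat :=
  count (fun c : config => query c.1 == Some i) (init x :: p).

End Computation.

Definition single_oracle (A : language) : unit -> language := fun=> A.

Definition double_oracle (A D : language) : bool -> language :=
  fun i => if i then D else A.

Definition polytime_computable (f : word -> word) : Prop :=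
  exists M : otm void, [/\ deterministic M, polytime M &
    forall x, exists p : seq (config M),
      [/\ computation (of_void language) x p,
          halted (last (init M x) p) &
          tape_word (last (init M x) p) (out_tape M) = f x]].

(* Self-delimiting code of a list of words: each bit [b] becomes [1b], and
   each word is closed by [0]. *)
Definition encode_word (w : word) : word :=
  rcons (flatten [seq [:: true; b] | b <- w]) false.

Definition encode_list (ws : seq word) : word :=
  flatten [seq encode_word w | w <- ws].

(* The number with binary notation [w], least significant bit first. *)
Definition binary_value (w : word) : nat :=
  foldr (fun (b : bool) v => b + v.*2) 0 w.

(* [k] is applied to input lengths, so its argument [n] is presented as [1^n],
   and "polynomial time" means polynomial in [n]. *)
Definition polytime_bound (k : nat -> nat) : Prop :=
  exists2 f, polytime_computable f &
    forall n, binary_value (f (nseq n true)) = k n.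

Definition polynomially_bounded (k : nat -> nat) : Prop :=
  exists e : nat, forall n, k n <= n ^ e + e.

Definition UP_le (h : nat) (A : language) : set language :=
  [set L | exists N : otm unit,
     [/\ polytime N,
         forall x, at_most_accepting_paths N h (single_oracle A) x &
         L = accepted N (single_oracle A)]].

(* [system_language A [:: N1; ...; Nj]] is L[A; N1, ..., Nj]; with no machine
   it is [A], so that the oracle of [N1] is always the language of the tail. *)
Fixpoint system_language (A : language) (Ns : seq (otm unit)) : language :=
  if Ns is N :: Ns' then accepted N (single_oracle (system_language A Ns'))
  else A.

Fixpoint polytime_system (Ns : seq (otm unit)) : Prop :=
  if Ns is N :: Ns' then polytime N /\ polytime_system Ns' else True.

Fixpoint unambiguous (A : language) (Ns : seq (otm unit)) : Prop :=
  if Ns is N :: Ns' then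
    (forall y,
       at_most_accepting_paths N 1 (single_oracle (system_language A Ns')) y)
    /\ unambiguous A Ns'
  else True.

Definition USigma (j : nat) (A : language) : set language :=
  [set L | exists Ns : seq (otm unit),
     [/\ size Ns = j, polytime_system Ns, unambiguous A Ns &
         L = system_language A Ns]].

Definition dtt_reducible (b : nat -> nat) (C : set language) : set language :=
  [set L | exists2 D, C D & exists f : word -> seq word,
     [/\ polytime_computable (encode_list \o f),
         forall x, size (f x) <= b (size x) &
         forall x, L x <-> exists2 y, y \in f x & D y]].

(* Only the queries to [D] are counted, oracle [true] of [double_oracle]. *)
Definition turing_reducible (k : nat -> nat) (A : language)
    (C : set language) : set language :=
  [set L | exists2 D, C D & exists M : otm bool,
     [/\ deterministic M, polytime M,
         forall x (p : seq (config M)), computation (double_oracle A D) x p ->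
           queries true x p <= k (size x) &
         L = accepted M (double_oracle A D)]].

(* Main.v *)
(** An unknown set [B] has at most [h] elements in each block, and the oracle
    answers membership queries about whole tuples of elements of a block.  The
    blocks [n, ..., n + k n] are listed by the reduction, which asks whether one
    of them is nonempty.  With a tuple as witness this is a question to
    [UP_le h], and counting from [h] down to 1 with unique witnesses (the sorted
    tuple of all elements of the block) makes it a question to [USigma h].

    An unambiguous system with [j] levels is insensitive at any [B] to adding
    almost every element of a block with room for [j + 1] further elements:
    otherwise many elements [z] each create an accepting path [p z] of the top
    machine; by induction its queries, hence the path, survive the addition of
    most other elements [w], and then [p z] and [p w] are two accepting paths
    for the same oracle.

    Now let a reduction ask at most [k n] questions on [1^n], and start with all
    blocks of the list empty.  Adding an element of any of the [k n + 1] blocks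
    must change the verdict, hence the answer to one of the at most [k n]
    questions, so two blocks share a question that most of their elements turn
    from no to yes.  Two such elements, one from each block, again give two
    accepting paths, and this time [h] levels are allowed because each block has
    room for [h] elements.  A generic set [B] defeats all reductions. *)

From HB Require Import structures.
Require Import Defs.
From mathcomp Require Import all_boot zify.
From mathcomp Require Import boolp classical_sets.

Set Implicit Arguments.
Unset Strict Implicit.
Unset Printing Implicit Defensive.

Local Open Scope classical_set_scope.

(** * Polynomial bounds *)

(** Unambiguity and the bound on the number of questions are promised only relative to the final
    oracle, so a machine may misbehave after a finite change of it. The way around is an argument by
    contradiction: if no finite condition defeats a reduction, then every finite extension that
    keeps the promise agrees with some set for which the reduction works, and since a computation
    sees only words of bounded length, the promises carry over to the extension. Hence additions are
    limited to [h] elements per block, and the room left in a block is accounted for level by level.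

    A word of length [m] has to code up to [h] elements of block [m], so an element has about
    [m / h] bits. This still leaves exponentially many candidates, against which all losses are
    polynomial.

    Machines are built on arbitrary finite types; they become countably many, as a generic
    construction requires, only up to isomorphism. The positive side needs explicit machines: one
    guessing machine serves both classes, and the list of blocks is produced by a machine that runs
    the one computing [k] and then counts its output down. *)

Definition poly_bounded (f : nat -> nat) : Prop :=
  exists e, forall n, f n <= n.+2 ^ e.

Lemma poly_bounded_le f g :
  (forall n, f n <= g n) -> poly_bounded g -> poly_bounded f.
Proof. by move=> fg [e ge]; exists e => n; exact: leq_trans (fg n) (ge n). Qed.

Lemma poly_bounded_const c : poly_bounded (fun=> c).
Proof.
by exists c => n; apply: ltnW; apply: ltn_expl.
Qed.

Lemma poly_bounded_id : poly_bounded id.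
Proof. by exists 1 => n; rewrite expn1; lia. Qed.

Lemma poly_bounded_add f g :
  poly_bounded f -> poly_bounded g -> poly_bounded (fun n => f n + g n).
Proof.
move=> [a fa] [b gb]; exists (a + b).+1 => n.
have Ha : n.+2 ^ a <= n.+2 ^ (a + b) by rewrite leq_exp2l // leq_addr.
have Hb : n.+2 ^ b <= n.+2 ^ (a + b) by rewrite leq_exp2l // leq_addl.
move: (fa n) (gb n); rewrite expnS; nia.
Qed.

Lemma poly_bounded_mul f g :
  poly_bounded f -> poly_bounded g -> poly_bounded (fun n => f n * g n).
Proof.
move=> [a fa] [b gb]; exists (a + b) => n.
by rewrite expnD leq_mul.
Qed.

Lemma poly_bounded_comp f g :
  poly_bounded f -> poly_bounded g -> poly_bounded (fun n => f (g n)).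
Proof.
move=> [a fa] [b gb]; exists (b.+2 * a) => n.
apply: leq_trans (fa (g n)) _; rewrite expnM.
case: a {fa} => [|a]; first by rewrite !expn0.
rewrite leq_exp2r //; move: (gb n); rewrite !expnS.
have : 0 < n.+2 ^ b by rewrite expn_gt0.
nia.
Qed.

Lemma poly_bounded_exp e : poly_bounded (fun n => n ^ e).
Proof.
elim: e => [|e IHe]; first exact: poly_bounded_const.
apply: (@poly_bounded_le _ (fun n => n * n ^ e)) => [n|].
  by rewrite expnS.
exact: poly_bounded_mul poly_bounded_id IHe.
Qed.

(** The base [n.+2] is at least 2, so that sums and products only add exponents; the bounds of the
    machines have the form [n ^ e + e]. For [n <= 1] the constant [3 ^ e] suffices, and from 2 on
    [n.+2 <= n ^ 2] doubles the exponent. *)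
Lemma poly_boundedE f :
  poly_bounded f <-> exists e, forall n, f n <= n ^ e + e.
Proof.
split=> [[e fe] | [e fe]]; last first.
  apply: poly_bounded_le fe _.
  exact: poly_bounded_add (poly_bounded_exp e) (poly_bounded_const e).
exists (3 ^ e + 2 * e) => n; apply: leq_trans (fe n) _.
have [n2|n2] := leqP n 1.
  have : n.+2 ^ e <= 3 ^ e.
    by case: e {fe} => // e; rewrite leq_exp2r //; lia.
  lia.
apply: leq_trans (leq_addr _ _).
apply: (@leq_trans (n ^ (2 * e))); last by rewrite leq_exp2l //; lia.
rewrite expnM; case: e {fe} => // e; rewrite leq_exp2r // expnS expn1; nia.
Qed.

Lemma leq_expD_exponent n a b : a <= b -> n ^ a + a <= n ^ b + b.
Proof.
case: n => [|n] ab; last by rewrite leq_add // leq_pexp2l.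
by case: a ab => [|a] ab; case: b ab => [|b] ab //; rewrite ?expn0 ?exp0n; lia.
Qed.

(** * Runs of oracle machines *)

Section Runs.
Context {I : finType} (M : otm I).
Implicit Types (O : I -> language) (c : config M) (p : seq (config M)).

Definition polytime_exp (e : nat) : Prop :=
  forall O x p, computation O x p -> size p <= size x ^ e + e.

Lemma polytime_exp_le e e' : e <= e' -> polytime_exp e -> polytime_exp e'.
Proof.
move=> ee' P O x p /P /leq_trans; apply.
exact: leq_expD_exponent.
Qed.

Lemma size_bits_of (s : seq (cell M)) : size (bits_of s) <= size s.
Proof. by elim: s => [|[[b|a]|] s IHs]. Qed.

Lemma step_growth O c c' t k l :
    step O c c' -> (c.2 t).2 <= k -> size (c.2 t).1 <= l + k ->
  (c'.2 t).2 <= k.+1 /\ size (c'.2 t).1 <= l + k.+1.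
Proof.
rewrite /step; case: (query c.1) => [i|] => [/eqP -> /=|]; first by lia.
case/existsP=> a /andP[_ /eqP ->] /= H1 H2; rewrite ffunE /act /=.
rewrite size_set_nth; split; last by lia.
by case: (a.2 t).2 => [[]|]; lia.
Qed.

Lemma computation_growth O x p t :
  computation O x p ->
  ((last (init M x) p).2 t).2 <= size p /\
  size ((last (init M x) p).2 t).1 <= size x + size p.
Proof.
rewrite /computation; elim/last_ind: p => [_|p c IHp] /=.
  rewrite ffunE; case: eqP => _ //=; rewrite ?size_map //.
  by rewrite addn0.
rewrite rcons_path last_rcons size_rcons => /andP[/IHp[H1 H2] s].
exact: step_growth s H1 H2.
Qed.

Definition asked x p (i : I) : seq word :=
  [seq tape_word c (query_tape M i) | c <- init M x :: p & query c.1 == Some i].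

Lemma size_asked x p i : size (asked x p i) = queries i x p.
Proof. by rewrite size_map size_filter. Qed.

Lemma size_asked_le x p i : size (asked x p i) <= (size p).+1.
Proof. by rewrite size_asked; apply: count_size. Qed.

(** A tape gains at most one cell per step, so a question is no longer than the input plus the time
    spent. *)
Lemma asked_length O x p i w :
  computation O x p -> w \in asked x p i -> size w <= size x + size p.
Proof.
move=> Hp /mapP[c]; rewrite mem_filter => /andP[_ Hc] ->.
apply: leq_trans (size_bits_of _) _.
move: Hc; rewrite inE => /orP[/eqP ->|].
  by have [_] := @computation_growth O x [::] (query_tape M i) isT; rewrite /=; lia.
move=> Hin; case/splitPr: Hin Hp => p1 p2.
rewrite /computation -cat_rcons cat_path => /andP[Hp _].
have [_] := computation_growth (query_tape M i) Hp.
by rewrite last_rcons size_cat size_rcons; lia.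
Qed.

Lemma step_asked O O' c c' :
    (forall i, query c.1 = Some i ->
       (tape_word c (query_tape M i) \in O i) =
       (tape_word c (query_tape M i) \in O' i)) ->
  step O c c' = step O' c c'.
Proof. by rewrite /step; case: (query c.1) => // i ->. Qed.

(** A path fixes its own questions, so the oracle enters only through the answers to them. All
    stability and locality arguments rest on this. *)
Lemma computation_asked O O' x p :
    (forall i w, w \in asked x p i -> (w \in O i) = (w \in O' i)) ->
  computation O x p = computation O' x p.
Proof.
rewrite /computation => H.
have {}H c : c \in init M x :: p -> forall c', step O c c' = step O' c c'.
  move=> Hc c'; apply: step_asked => i ci; apply: H.
  by apply/mapP; exists c => //; rewrite mem_filter ci eqxx.
elim: p (init M x) H => //= c p IHp c0 H.
rewrite H ?mem_head // IHp // => c1 c1p; apply: H.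
by rewrite inE c1p orbT.
Qed.

Lemma accepting_path_asked O O' x p :
    (forall i w, w \in asked x p i -> (w \in O i) = (w \in O' i)) ->
  accepting_path O x p = accepting_path O' x p.
Proof. by move=> H; rewrite /accepting_path (computation_asked H). Qed.

Lemma not_halted_step O c : ~~ halted c -> exists c', step O c c'.
Proof.
rewrite /halted /step; case: (query c.1) => [i|] /=; first by eexists; exact/eqP.
rewrite cards_eq0 => /set0Pn[a Ha].
eexists; apply/existsP; exists a; rewrite Ha; exact: eqxx.
Qed.

Lemma halted_no_step O c c' : halted c -> ~~ step O c c'.
Proof.
rewrite /halted /step => /andP[/eqP ->]; rewrite cards_eq0 => /eqP ->.
by apply/existsP => -[a]; rewrite inE.
Qed.

Lemma deterministic_step O c c1 c2 :
  deterministic M -> step O c c1 -> step O c c2 -> c1 = c2.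
Proof.
move=> D; rewrite /step; case: (query c.1) => [i /eqP -> /eqP -> //|].
case/existsP=> a /andP[Ha /eqP ->] /existsP[b /andP[Hb /eqP ->]].
by have /card_le1_eqP E := D c.1 (scan c); rewrite (E a b).
Qed.

Lemma deterministic_prefix O c p q :
    deterministic M -> path (step O) c p -> path (step O) c q ->
  halted (last c q) -> exists r, q = p ++ r.
Proof.
move=> D; elim: p c q => [|c1 p IHp] c q; first by exists q.
case: q => [|c2 q] /= /andP[s1 Hp].
  by move=> _ h; case/negP: (@halted_no_step O c c1 h).
case/andP=> s2 Hq Hh; have E := deterministic_step D s1 s2.
rewrite -E in Hq Hh; have [r ->] := IHp _ _ Hp Hq Hh.
by exists r; rewrite E.
Qed.

(** Without a halting computation every computation could be prolonged, eventually beyond the time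
    bound. *)
Lemma longest_computation O x e :
  polytime_exp e ->
  exists2 p, computation O x p & halted (last (init M x) p).
Proof.
move=> P; apply: contrapT => N.
have H n : exists2 p : seq (config M), computation O x p & size p = n.
  elim: n => [|n [p Hp sp]]; first by exists [::].
  have [h|h] := boolP (halted (last (init M x) p)); first by case: N; exists p.
  have [c' Hc'] := not_halted_step O h.
  by exists (rcons p c'); rewrite ?size_rcons ?sp // /computation rcons_path Hc' andbT.
have [p /P] := H (size x ^ e + e).+1.
lia.
Qed.

End Runs.
Arguments asked {I M}.

(** * Machines up to isomorphism *)

Definition map_cell (A B : Type) (f : A -> B) :
    option (bool + A) -> option (bool + B) :=
  omap (fun x => match x with inl b => inl b | inr y => inr (f y) end).

Lemma map_cellK (A B : Type) (f : A -> B) g :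
  cancel f g -> cancel (map_cell f) (map_cell g).
Proof. by move=> fK [[b|y]|] //=; rewrite fK. Qed.

Section Isomorphism.
Context {I : finType}.

Section Maps.
Context (M M' : otm I) (fs : state M -> state M') (fy : symbol M -> symbol M')
  (gt : tape M' -> tape M).

Definition map_scan (s : {ffun tape M -> cell M}) :
    {ffun tape M' -> cell M'} :=
  [ffun t => map_cell fy (s (gt t))].

Definition map_transition
    (a : state M * {ffun tape M -> cell M * option bool}) :
    state M' * {ffun tape M' -> cell M' * option bool} :=
  (fs a.1, [ffun t => (map_cell fy (a.2 (gt t)).1, (a.2 (gt t)).2)]).

Definition map_config (c : config M) : config M' :=
  (fs c.1, [ffun t => (map (map_cell fy) (c.2 (gt t)).1, (c.2 (gt t)).2)]).

End Maps.

(** Serves to replace a machine by a coded one without changing its paths. Tape contents and scanned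
    symbols are functions on tapes and are transported by composing with the inverse tape map, which
    is why [iso_delta] mentions [iso_ta']. *)
Record otm_iso (M M' : otm I) := OtmIso {
  iso_st : state M -> state M'; iso_st' : state M' -> state M;
  iso_sy : symbol M -> symbol M'; iso_sy' : symbol M' -> symbol M;
  iso_ta : tape M -> tape M'; iso_ta' : tape M' -> tape M;
  iso_stK : cancel iso_st iso_st'; iso_stK' : cancel iso_st' iso_st;
  iso_syK : cancel iso_sy iso_sy'; iso_syK' : cancel iso_sy' iso_sy;
  iso_taK : cancel iso_ta iso_ta'; iso_taK' : cancel iso_ta' iso_ta;
  iso_start : iso_st (start M) = start M';
  iso_accepting : forall q, accepting (iso_st q) = accepting q;
  iso_in : iso_ta (in_tape M) = in_tape M';
  iso_query_tape : forall i, iso_ta (query_tape M i) = query_tape M' i;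
  iso_query : forall q, query (iso_st q) = query q;
  iso_answer : forall q b, answer (iso_st q) b = iso_st (answer q b);
  iso_delta : forall q s a,
    (map_transition iso_st iso_sy iso_ta' a \in
       delta (iso_st q) (map_scan iso_sy iso_ta' s)) = (a \in delta q s)
}.

Definition iso_config (M M' : otm I) (E : otm_iso M M') : config M -> config M' :=
  map_config (iso_st E) (iso_sy E) (iso_ta' E).

Definition otm_iso_sym (M M' : otm I) (E : otm_iso M M') : otm_iso M' M.
Proof.
refine (@OtmIso M' M (iso_st' E) (iso_st E) (iso_sy' E) (iso_sy E) (iso_ta' E)
  (iso_ta E) (iso_stK' E) (iso_stK E) (iso_syK' E) (iso_syK E) (iso_taK' E)
  (iso_taK E) _ _ _ _ _ _ _).
- by rewrite -(iso_start E) iso_stK.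
- by move=> q; rewrite -(iso_accepting E) iso_stK'.
- by rewrite -(iso_in E) iso_taK.
- by move=> i; rewrite -(iso_query_tape E) iso_taK.
- by move=> q; rewrite -(iso_query E) iso_stK'.
- by move=> q b; rewrite -{2}[q](iso_stK' E) iso_answer iso_stK.
- move=> q s a; rewrite -(iso_delta E) iso_stK'; congr (_ \in delta _ _).
    case: a => q' a; rewrite /map_transition /= iso_stK'; congr (_, _).
    apply/ffunP=> t; rewrite !ffunE iso_taK' /=.
    by rewrite (map_cellK (iso_syK' E)); case: (a t).
  by apply/ffunP=> t; rewrite !ffunE iso_taK' (map_cellK (iso_syK' E)).
Defined.

Lemma iso_configK (M M' : otm I) (E : otm_iso M M') :
  cancel (iso_config E) (iso_config (otm_iso_sym E)).
Proof.
case=> q c; rewrite /iso_config /map_config /= iso_stK; congr (_, _).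
apply/ffunP=> t; rewrite !ffunE iso_taK /= (mapK (map_cellK (iso_syK E))).
by case: (c t).
Qed.

Lemma iso_init (M M' : otm I) (E : otm_iso M M') x :
  iso_config E (init M x) = init M' x.
Proof.
rewrite /iso_config /map_config /init /= iso_start; congr (_, _).
apply/ffunP=> t; rewrite !ffunE /= -(iso_in E).
rewrite -(inj_eq (can_inj (iso_taK E))) iso_taK'.
by case: eqP => _ //=; rewrite -map_comp.
Qed.

Lemma iso_tape_word (M M' : otm I) (E : otm_iso M M') c i :
  tape_word (iso_config E c) (query_tape M' i) = tape_word c (query_tape M i).
Proof.
rewrite /tape_word ffunE -(iso_query_tape E) iso_taK /=.
by elim: (c.2 _).1 => [|[[b|a]|] s IHs] //=; rewrite IHs.
Qed.

Lemma iso_scan (M M' : otm I) (E : otm_iso M M') c :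
  scan (iso_config E c) = map_scan (iso_sy E) (iso_ta' E) (scan c).
Proof.
apply/ffunP=> t; rewrite !ffunE /=.
set s := (c.2 _).1; set k := (c.2 _).2.
by elim: s k => [|u s IHs] [|k] //=.
Qed.

Lemma map_set_nth (A B : Type) (f : A -> B) x s k y :
  map f (set_nth x s k y) = set_nth (f x) (map f s) k (f y).
Proof.
elim: s k => [|z s IHs] [|k] //=; last by rewrite IHs.
by congr (_ :: _); elim: k => //= k ->.
Qed.

Lemma iso_step (M M' : otm I) (E : otm_iso M M') O c c' :
  step O c c' -> step O (iso_config E c) (iso_config E c').
Proof.
rewrite /step /= iso_query; case: (query c.1) => [i /eqP ->|].
  by rewrite iso_tape_word iso_answer.
case/existsP=> a /andP[Ha /eqP ->]; apply/existsP.
exists (map_transition (iso_st E) (iso_sy E) (iso_ta' E) a).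
rewrite iso_scan iso_delta Ha /=; apply/eqP; congr (_, _).
apply/ffunP=> t; rewrite !ffunE /act /=; congr (_, _).
by rewrite map_set_nth.
Qed.

Lemma iso_stepE (M M' : otm I) (E : otm_iso M M') O c c' :
  step O (iso_config E c) (iso_config E c') = step O c c'.
Proof.
apply/idP/idP; last exact: iso_step.
by move/(iso_step (otm_iso_sym E)); rewrite !iso_configK.
Qed.

Lemma iso_computation (M M' : otm I) (E : otm_iso M M') O x p :
  computation O x (map (iso_config E) p) = computation O x p.
Proof.
rewrite /computation -(iso_init E).
by elim: p (init M x) => //= c p IHp c0; rewrite iso_stepE IHp.
Qed.

Lemma iso_delta_card (M M' : otm I) (E : otm_iso M M') q s :
  #|delta (iso_st E q) (map_scan (iso_sy E) (iso_ta' E) s)| = #|delta q s|.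
Proof.
set f := map_transition (iso_st E) (iso_sy E) (iso_ta' E).
have fK : cancel f (map_transition (iso_st' E) (iso_sy' E) (iso_ta E)).
  case=> r a; rewrite /f /map_transition /= iso_stK; congr (_, _).
  apply/ffunP=> t; rewrite !ffunE iso_taK /= (map_cellK (iso_syK E)).
  by case: (a t).
have fK' : cancel (map_transition (iso_st' E) (iso_sy' E) (iso_ta E)) f.
  case=> r a; rewrite /f /map_transition /= iso_stK'; congr (_, _).
  apply/ffunP=> t; rewrite !ffunE iso_taK' /= (map_cellK (iso_syK' E)).
  by case: (a t).
rewrite -(card_imset _ (can_inj fK)); apply: eq_card => b.
by rewrite -[b]fK' iso_delta (mem_imset _ _ (can_inj fK)).
Qed.

Lemma iso_accepting_path (M M' : otm I) (E : otm_iso M M') O x p :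
  accepting_path O x (map (iso_config E) p) = accepting_path O x p.
Proof.
rewrite /accepting_path iso_computation -(iso_init E) last_map /halted.
by rewrite iso_scan iso_delta_card /= iso_query iso_accepting.
Qed.

Lemma iso_queries (M M' : otm I) (E : otm_iso M M') i x p :
  queries i x (map (iso_config E) p) = queries i x p.
Proof.
rewrite /queries -(iso_init E) -map_cons count_map.
by apply: eq_count => c /=; rewrite iso_query.
Qed.

Lemma iso_accepted (M M' : otm I) (E : otm_iso M M') O :
  accepted M O = accepted M' O.
Proof.
apply/seteqP; split=> x [p Hp].
  by exists (map (iso_config E) p); rewrite iso_accepting_path.
exists (map (iso_config (otm_iso_sym E)) p).
by rewrite iso_accepting_path.
Qed.

Lemma iso_polytime_exp (M M' : otm I) (E : otm_iso M M') e :
  polytime_exp M e -> polytime_exp M' e.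
Proof.
move=> P O x p; rewrite -(iso_computation (otm_iso_sym E)) => /P.
by rewrite size_map.
Qed.

Lemma iso_at_most (M M' : otm I) (E : otm_iso M M') h O x :
  at_most_accepting_paths M h O x -> at_most_accepting_paths M' h O x.
Proof.
move=> H ps ups aps; rewrite -(size_map (map (iso_config (otm_iso_sym E)))).
apply: H.
  rewrite map_inj_uniq //; apply: inj_map.
  exact: can_inj (iso_configK (otm_iso_sym E)).
by rewrite all_map; apply: sub_all aps => p /=; rewrite iso_accepting_path.
Qed.

Lemma iso_deterministic (M M' : otm I) (E : otm_iso M M') :
  deterministic M -> deterministic M'.
Proof. by move=> D q s; rewrite -(iso_delta_card (otm_iso_sym E)). Qed.

(** With ordinals for states, symbols and tapes, and finite functions for all components, the
    machines of a given size form a finite type; the sum over all sizes is then countable. *)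
Definition otm_table (n : nat * nat * nat) : finType :=
  let: (a, b, c) := n in
  (('I_a * {ffun 'I_a -> bool} * 'I_c * 'I_c * {ffun I -> 'I_c}) *
   ({ffun 'I_a -> option I} * {ffun 'I_a * bool -> 'I_a} *
    {ffun 'I_a * {ffun 'I_c -> option (bool + 'I_b)} ->
       {set 'I_a * {ffun 'I_c -> option (bool + 'I_b) * option bool}}}))%type.

Definition otm_code : Type := {n : nat * nat * nat & otm_table n}.

Definition otm_of_table a b c (T : otm_table (a, b, c)) : otm I :=
  let: ((q0, acc, ti, to, qt), (qu, an, d)) := T in
  @OTM I 'I_a 'I_b 'I_c q0 acc ti to qt qu (fun q r => an (q, r))
    (fun q s => d (q, s)).

Definition otm_of_code (u : otm_code) : otm I :=
  let: existT n T := u in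
  (let: (a, b, c) as n := n return otm_table n -> otm I in @otm_of_table a b c) T.

Lemma otm_of_code_surj (M : otm I) : exists u, inhabited (otm_iso M (otm_of_code u)).
Proof.
pose sy := @enum_rank (symbol M); pose sy' := @enum_val (symbol M) (symbol M).
pose st := @enum_rank (state M); pose st' := @enum_val (state M) (state M).
pose ta := @enum_rank (tape M); pose ta' := @enum_val (tape M) (tape M).
pose tr (a : state M * {ffun tape M -> cell M * option bool}) :
    'I_#|state M| * {ffun 'I_#|tape M| ->
      option (bool + 'I_#|symbol M|) * option bool} :=
  (st a.1, [ffun t => (map_cell sy (a.2 (ta' t)).1, (a.2 (ta' t)).2)]).
pose T : otm_table (#|state M|, #|symbol M|, #|tape M|) :=
  ((st (start M), [ffun q => accepting (st' q)], ta (in_tape M),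
    ta (out_tape M), [ffun i => ta (query_tape M i)]),
   ([ffun q => query (st' q)], [ffun qb => st (answer (st' qb.1) qb.2)],
    [ffun qs : 'I_#|state M| *
        {ffun 'I_#|tape M| -> option (bool + 'I_#|symbol M|)} =>
       [set tr a | a in delta (st' qs.1) [ffun t => map_cell sy' (qs.2 (ta t))]]%SET])).
exists (existT _ (#|state M|, #|symbol M|, #|tape M|) T).
constructor.
refine (@OtmIso M (otm_of_table T) st st' sy sy' ta ta' _ _ _ _ _ _ _ _ _ _ _ _ _);
  rewrite /st /sy /ta /st' /sy' /ta' /=; try by move=> ?; rewrite ?enum_rankK ?enum_valK.
- by [].
- by move=> q; rewrite ffunE /st' enum_rankK.
- by [].
- by move=> i; rewrite ffunE.
- by move=> q; rewrite ffunE /st' enum_rankK.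
- by move=> q b; rewrite ffunE /= /st' enum_rankK.
- move=> q s a; rewrite ffunE /= /st' enum_rankK.
  have fI : injective tr.
    move=> [q1 a1] [q2 a2] [/enum_rank_inj -> /ffunP H]; congr (_, _).
    apply/ffunP=> t; move: (H (enum_rank t)); rewrite !ffunE /ta' enum_rankK /=.
    case: (a1 t) (a2 t) => [c1 m1] [c2 m2] /= [Hc ->]; congr (_, _).
    exact: (can_inj (map_cellK (@enum_rankK _))) Hc.
  rewrite (_ : [ffun t => _] = s); last first.
    apply/ffunP=> t; rewrite !ffunE /ta enum_rankK.
    exact: (map_cellK (@enum_rankK _)).
  by rewrite (mem_imset _ _ fI).
Qed.

End Isomorphism.
Arguments otm_code : clear implicits.
HB.instance Definition _ I := Countable.copy (otm_code I) {n : nat * nat * nat & otm_table n}.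

(** * The oracle of a sparse set *)

Definition elt : Type := (nat * word)%type.

(** The enumeration order is the order in which tuples are sorted: being a [subseq] of the pool
    makes a tuple sorted and free of repetitions, so a set of elements has exactly one tuple. *)
Definition pool (g : nat) : seq word := [seq val t | t <- enum {: g.-tuple bool}].

Lemma mem_pool g z : (z \in pool g) = (size z == g).
Proof.
apply/mapP/idP => [[t _ ->]|gz]; first by rewrite size_tuple.
by exists (Tuple gz); rewrite ?mem_enum.
Qed.

Lemma pool_uniq g : uniq (pool g).
Proof. by rewrite map_inj_uniq ?enum_uniq //; exact: val_inj. Qed.

Lemma size_pool g : size (pool g) = 2 ^ g.
Proof. by rewrite size_map -cardE card_tuple card_bool. Qed.

Section Oracle.
Variable h : nat.

(** The length of an element of block [m]. The code of an [h]-tuple needs [h + 1] bits for the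
    prefix, [h] chunks, and at least one final 0; hence [h.+2] is set aside before dividing. *)
Definition chunk (m : nat) : nat := (m - h.+2) %/ h.

(* The prefix [1^i 0] fixes the number [i] of components.  The last bit is 0:
   words ending in 1 are left for the counting questions of [guess_machine]. *)
Definition code_tuple (m : nat) (s : seq word) : word :=
  nseq (size s) true ++ false ::
  flatten s ++ nseq (m - ((size s).+1 + size (flatten s))) false.

Definition tuple_ok (m : nat) (s : seq word) : bool :=
  [&& 0 < chunk m, 0 < size s <= h & subseq s (pool (chunk m))].

Lemma tuple_ok_size m s :
  tuple_ok m s -> size (flatten s) = size s * chunk m.
Proof.
case/and3P=> _ _ /mem_subseq sp.
elim: s sp => [|z s IHs] //= sp; rewrite size_cat IHs.
  by have := sp z; rewrite mem_head mem_pool => /(_ isT) /eqP ->.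
by move=> y ys; apply: sp; rewrite inE ys orbT.
Qed.

(** The inequality is strict, so the padding is nonempty and a code really ends in 0. *)
Lemma tuple_ok_fits m s :
  tuple_ok m s -> (size s).+1 + size (flatten s) < m.
Proof.
move=> ok; rewrite (tuple_ok_size ok); case/and3P: ok => g0 /andP[_ sh] _.
have : h * chunk m <= m - h.+2 by rewrite mulnC /chunk leq_trunc_div.
have : size s * chunk m <= h * chunk m by rewrite leq_mul2r sh orbT.
have : h < m - h.+1.
  have : 0 < h by rewrite lt0n; apply/eqP=> h0; move: g0; rewrite /chunk h0 divn0.
  move: g0; rewrite /chunk => /[swap] h0; rewrite divn_gt0 //; lia.
lia.
Qed.

Lemma size_code_tuple m s : tuple_ok m s -> size (code_tuple m s) = m.
Proof.
move=> /tuple_ok_fits; rewrite /code_tuple size_cat /= size_cat !size_nseq; lia.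
Qed.

Lemma last_code_tuple m s b : tuple_ok m s -> last b (code_tuple m s) = false.
Proof.
move=> /tuple_ok_fits ok; rewrite /code_tuple last_cat /= last_cat.
have -> : m - ((size s).+1 + size (flatten s)) =
  (m - ((size s).+2 + size (flatten s))).+1 by lia.
by move: (_ - _) => k /=; elim: k.
Qed.

Lemma find_nseq_true i u : find negb (nseq i true ++ false :: u) = i.
Proof. by elim: i => //= i ->. Qed.

(** The prefix yields the number of components, and as all of them have length [chunk m], the
    concatenation can be cut in only one way. *)
Lemma code_tuple_inj m s s' :
  tuple_ok m s -> tuple_ok m s' -> code_tuple m s = code_tuple m s' -> s = s'.
Proof.
move=> ok ok' E.
have Es : size s = size s'.
  by move/(congr1 (find negb)): E; rewrite !find_nseq_true.
move: E; rewrite /code_tuple -Es => /eqP.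
rewrite eqseq_cat // eqxx /= eqseq_cons eqxx /=.
rewrite (eqseq_cat _ _ (_ : size (flatten s) = size (flatten s'))); last first.
  by rewrite (tuple_ok_size ok) (tuple_ok_size ok') Es.
case/andP=> /eqP Ef _.
have shp u : tuple_ok m u -> shape u = nseq (size u) (chunk m).
  case/and3P=> _ _ /mem_subseq up.
  have /all_pred1P : all (pred1 (chunk m)) (shape u).
    by apply/allP => x /mapP[z /up]; rewrite mem_pool => zs ->.
  by rewrite size_map.
by rewrite -(flattenK s) -(flattenK s') Ef (shp s) ?(shp s') // Es.
Qed.

Definition oracle (B : set elt) : language :=
  [set w | exists2 s, tuple_ok (size w) s &
     w = code_tuple (size w) s /\ {in s, forall z, B (size w, z)}].

(** A word codes at most one tuple, so its membership depends on at most [h] elements, all in the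
    block of its own length. This is the base of the insensitivity argument, and it turns agreement
    of sets below a length into agreement of oracles on shorter words. *)
Lemma oracle_local w : exists2 zs : seq elt,
  (size zs <= h) && all (fun x => x.1 == size w) zs &
  forall B B' : set elt, {in zs, forall x, B x <-> B' x} ->
    (w \in oracle B) = (w \in oracle B').
Proof.
have [[s ok ws]|N] := pselect (exists2 s, tuple_ok (size w) s &
  w = code_tuple (size w) s); last first.
  exists [::] => // B B' _; apply/idP/idP; rewrite !inE => -[s ok [ws _]];
  by case: N; exists s.
exists [seq (size w, z) | z <- s].
  rewrite size_map; case/and3P: ok => _ /andP[_ ->] _ /=.
  by rewrite all_map; apply/allP => z _ /=.
have H B B' : {in [seq (size w, z) | z <- s], forall x, B x <-> B' x} ->
    oracle B w -> oracle B' w.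
  move=> BB' [s' ok' [ws' Bs']]; exists s => //; split=> // z zs.
  have E : s = s' by apply: (code_tuple_inj ok ok'); rewrite -ws -ws'.
  have Hz : (size w, z) \in [seq (size w, z) | z <- s] by apply: map_f.
  by apply/(BB' _ Hz); apply: Bs'; rewrite -E.
move=> B B' BB'; apply/idP/idP; rewrite !inE; apply: H => // x /BB' Bx.
by split=> /Bx.
Qed.

Definition in_block (m : nat) (x : elt) : bool :=
  [&& x.1 == m, 0 < chunk m & size x.2 == chunk m].

Definition promise (B : set elt) : Prop :=
  (forall x, B x -> in_block x.1 x) /\
  forall m (s : seq elt), uniq s ->
    {in s, forall x, B x /\ x.1 = m} -> size s <= h.

End Oracle.

(** * Insensitivity of unambiguous systems *)

(** A cardinality bound through duplicate-free lists applies to undecided predicates on infinite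
    types. *)
Definition at_most_many (T : eqType) (c : nat) (P : T -> Prop) : Prop :=
  forall s, uniq s -> {in s, forall x, P x} -> size s <= c.

Lemma at_most_many_sub (T : eqType) c (P Q : T -> Prop) :
  (forall x, P x -> Q x) -> at_most_many c Q -> at_most_many c P.
Proof. by move=> PQ H s us Ps; apply: H => // x /Ps /PQ. Qed.

Lemma at_most_many_le (T : eqType) c c' (P : T -> Prop) :
  c <= c' -> at_most_many c P -> at_most_many c' P.
Proof. by move=> cc' H s us Ps; apply: leq_trans (H s us Ps) cc'. Qed.

Lemma at_most_many_or (T : eqType) c c' (P Q : T -> Prop) :
  at_most_many c P -> at_most_many c' Q ->
  at_most_many (c + c') (fun x => P x \/ Q x).
Proof.
move=> HP HQ s us Hs; pose a x := `[< P x >].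
rewrite -(count_predC a s) -!size_filter; apply: leq_add.
  apply: HP; rewrite ?filter_uniq // => x.
  by rewrite mem_filter => /andP[/asboolP].
apply: HQ; rewrite ?filter_uniq // => x.
by rewrite mem_filter => /andP[/asboolPn nP /Hs[]].
Qed.

Lemma at_most_many_has (T : eqType) (U : eqType) c (r : seq U)
    (P : U -> T -> Prop) :
  {in r, forall u, at_most_many c (P u)} ->
  at_most_many (size r * c) (fun x => exists2 u, u \in r & P u x).
Proof.
elim: r => [_ [|x s] // us /(_ x (mem_head _ _))[]//|u r IHr Hr] /=.
rewrite mulSn.
apply: (@at_most_many_sub _ _ _
  (fun x => P u x \/ exists2 u, u \in r & P u x)) => [x [v]|].
  by rewrite inE => /predU1P[-> |vr] Pv; [left|right; exists v].
apply: at_most_many_or; first by apply: Hr; rewrite mem_head.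
by apply: IHr => v vr; apply: Hr; rewrite inE vr orbT.
Qed.

Lemma at_most_many_pick (T : eqType) c (P : T -> Prop) s :
    at_most_many c P -> uniq s -> c < size s ->
  exists2 x, x \in s & ~ P x.
Proof.
move=> H us cs; apply: contrapT => N.
have : size s <= c by apply: H => // x xs; apply: contrapT => nP; apply: N; exists x.
lia.
Qed.

(** All elements of [s1] together exclude at most [size s1 * c] elements of [s2]. A [w] that escapes
    them all excludes in turn at most [c] elements of [s1]. The product on one side is the origin of
    the square in [sensitivity]. *)
Lemma mutual_survivors (T : eqType) c s1 s2 (P Q : T -> T -> Prop) :
    {in s1, forall z, at_most_many c (P z)} ->
    {in s2, forall w, at_most_many c (Q w)} ->
    uniq s1 -> uniq s2 -> c < size s1 -> size s1 * c < size s2 ->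
  exists z w, [/\ z \in s1, w \in s2, ~ P z w & ~ Q w z].
Proof.
move=> HP HQ u1 u2 c1 c2.
have [w w2 nP] := at_most_many_pick (at_most_many_has HP) u2 c2.
have [z z1 nQ] := at_most_many_pick (HQ w w2) u1 c1.
by exists z, w; split=> // Pzw; apply: nP; exists z.
Qed.

Section Insensitivity.
Variables (h e : nat) (B0 : set elt) (F : pred nat).

(** Bounds both the number and the length of the questions on inputs of length at most [l]; the 1
    accounts for the initial configuration. *)
Definition reach (l : nat) : nat := l + (l ^ e + e) + 1.

Definition oracle_at (T : seq elt) : language :=
  oracle h [set x | B0 x \/ x \in T].

Definition load (m : nat) (T : seq elt) : nat := count (fun x : elt => x.1 == m) T.

(** The additions for which unambiguity will be available: they keep the promise when the free
    blocks [F] are empty in [B0]. *)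
Definition legal (T : seq elt) : Prop :=
  all (fun x => F x.1 && in_block h x.1 x) T /\
  forall m, load m T <= h.

Definition system_at (Ns : seq (otm unit)) (T : seq elt) : language :=
  system_language (oracle_at T) Ns.

Definition flips (Ns : seq (otm unit)) (y : word) (T : seq elt) (x : elt) : Prop :=
  (y \in system_at Ns (x :: T)) != (y \in system_at Ns T).

(** Restricting each level to the inputs that can reach it makes unambiguity depend on finitely many
    oracle words, so that it passes from a completed set to a finite extension. *)
Fixpoint unambiguous_upto (A : language) (Ns : seq (otm unit)) (l : nat) : Prop :=
  if Ns is N :: Ns' then
    (forall y, size y <= l ->
       at_most_accepting_paths N 1 (single_oracle (system_language A Ns')) y)
    /\ unambiguous_upto A Ns' (reach l)
  else True.

Fixpoint polytime_exp_all (Ns : seq (otm unit)) : Prop :=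
  if Ns is N :: Ns' then polytime_exp N e /\ polytime_exp_all Ns' else True.

(** With [K = 2 * (reach l * c)], where [c] is the bound one level below, more than [(K + 1) ^ 2]
    elements split into [K + 1] of them and more than [(K + 1) * K] others, as [mutual_survivors]
    demands. With no machine, a word depends on at most [h] elements. *)
Fixpoint sensitivity (j l : nat) : nat :=
  if j is j'.+1 then (2 * (reach l * sensitivity j' (reach l))).+1 ^ 2 else h.

Lemma system_at_swap Ns T x y : system_at Ns (x :: y :: T) = system_at Ns (y :: x :: T).
Proof.
rewrite /system_at /oracle_at; congr (system_language (oracle h _) _).
by apply/seteqP; split=> z /=; rewrite !inE (orbCA (z == x)).
Qed.

Lemma asked_bounds (I : finType) (N : otm I) O y (p : seq (config N)) l i :
    polytime_exp N e -> size y <= l -> computation O y p ->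
  size (asked y p i) <= reach l /\
  forall q, q \in asked y p i -> size q <= reach l.
Proof.
move=> P yl Hp; have sp := P _ _ _ Hp.
have ye : size y ^ e <= l ^ e by case: (e) => [|d]; rewrite ?expn0 ?leq_exp2r.
split; first by have := size_asked_le y p i; rewrite /reach; lia.
by move=> q /(asked_length Hp); rewrite /reach; lia.
Qed.

Lemma accepting_path_flips (N : otm unit) Ns y (p : seq (config N)) T x :
  ~ (exists2 q, q \in asked y p tt & flips Ns q T x) ->
  accepting_path (single_oracle (system_at Ns (x :: T))) y p =
  accepting_path (M := N) (single_oracle (system_at Ns T)) y p.
Proof.
move=> H; apply: accepting_path_asked => -[] q Hq; apply/eqP.
by apply/negPn/negP => fl; apply: H; exists q.
Qed.

Lemma accepting_path_bounds (N : otm unit) O y (p : seq (config N)) l :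
    polytime_exp N e -> size y <= l -> accepting_path (M := N) O y p ->
  size (asked y p tt) <= reach l /\
  forall q, q \in asked y p tt -> size q <= reach l.
Proof. by move=> P yl /and3P[Hp _ _]; exact: asked_bounds P yl Hp. Qed.

(** Each element of either family creates an accepting path, whose few questions are stable under
    most of the other family. The path of [z] must survive the addition of [w] both to [z :: T], to
    live on, and to [T], to differ from the path of [w]; this causes the factor 2. Two separate
    families allow both uses: two parts of one block, and two different blocks. *)
Lemma ambiguity (N : otm unit) Ns l c T y s1 s2 :
    polytime_exp N e -> size y <= l -> y \notin system_at (N :: Ns) T ->
    {in s1, forall z, y \in system_at (N :: Ns) (z :: T)} ->
    {in s2, forall w, y \in system_at (N :: Ns) (w :: T)} ->
    (forall q, size q <= reach l ->
       at_most_many c (fun w => w \in s2 /\ flips Ns q T w)) ->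
    {in s1, forall z q, size q <= reach l ->
       at_most_many c (fun w => w \in s2 /\ flips Ns q (z :: T) w)} ->
    {in s2, forall w q, size q <= reach l ->
       at_most_many c (fun z => z \in s1 /\ flips Ns q (w :: T) z)} ->
    {in s1 & s2, forall z w,
       at_most_accepting_paths N 1 (single_oracle (system_at Ns (z :: w :: T))) y} ->
    uniq s1 -> uniq s2 -> 2 * (reach l * c) < size s1 ->
    size s1 * (2 * (reach l * c)) < size s2 -> False.
Proof.
move=> P yl nyT y1 y2 ins0 ins1 ins2 un u1 u2 K1 K2.
have /choice[f Hf] (z : elt) : exists p : seq (config N), 
    z \in s1 \/ z \in s2 ->
    accepting_path (single_oracle (system_at Ns (z :: T))) y p.
  have [Hz|Hz] := pselect (z \in s1 \/ z \in s2); last by exists [::].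
  have : y \in system_at (N :: Ns) (z :: T) by case: Hz => [/y1|/y2].
  by rewrite inE => -[p Hp]; exists p.
pose bad (s : seq elt) U z w :=
  w \in s /\ exists2 q, q \in asked y (f z) tt & flips Ns q U w.
have bad_few s U z : z \in s1 \/ z \in s2 ->
    (forall q, size q <= reach l ->
       at_most_many c (fun w => w \in s /\ flips Ns q U w)) ->
    at_most_many (reach l * c) (bad s U z).
  move=> Hz ins; have [sz lq] := accepting_path_bounds P yl (Hf z Hz).
  apply: (@at_most_many_le _ (size (asked y (f z) tt) * c)).
    by rewrite leq_mul2r sz orbT.
  apply: (@at_most_many_sub _ _ _ (fun w => exists2 q, q \in asked y (f z) tt &
    w \in s /\ flips Ns q U w)) => [w [ws [q Hq fl]]|]; first by exists q.
  by apply: at_most_many_has => q /lq; apply: ins.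
have [z [w [z1 w2 nP nQ]]] : exists z w, [/\ z \in s1, w \in s2,
    ~ (bad s2 T z w \/ bad s2 (z :: T) z w) & ~ bad s1 (w :: T) w z].
  apply: (mutual_survivors (c := 2 * (reach l * c))) => // [z z1|w w2].
    rewrite mul2n -addnn; apply: at_most_many_or; apply: bad_few; try by left.
      exact: ins0.
    exact: ins1.
  apply: (@at_most_many_le _ (reach l * c)); first lia.
  by apply: bad_few; [right|exact: ins2].
have Hz := Hf z (or_introl z1); have Hw := Hf w (or_intror w2).
have Hzw : accepting_path (single_oracle (system_at Ns (z :: w :: T))) y (f z).
  rewrite system_at_swap accepting_path_flips // => bz.
  by apply: nP; right; split.
have Hwz : accepting_path (single_oracle (system_at Ns (z :: w :: T))) y (f w).
  by rewrite accepting_path_flips // => bw; apply: nQ; split.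
(* A common path would accept at [w :: T] without a question that [w] changes at [T], hence would
   accept already at [T]. *)
have ne : f z != f w.
  apply/eqP => Ezw; case/negP: nyT; rewrite inE; exists (f z).
  change (accepting_path (single_oracle (system_at Ns T)) y (f z)).
  rewrite -(@accepting_path_flips _ _ _ _ _ w) ?Ezw //.
  by move=> bz; apply: nP; left; split => //; rewrite Ezw.
have := un z w z1 w2 [:: f z; f w].
by rewrite /= inE ne Hzw Hwz => /(_ isT isT).
Qed.

(** To lose a yes, every accepting path must break; one fixed path breaks only when one of its at
    most [reach l] questions changes its answer. *)
Lemma negative_flips (N : otm unit) Ns l c T y (P : elt -> Prop) :
    polytime_exp N e -> size y <= l -> y \in system_at (N :: Ns) T ->
    (forall q, size q <= reach l ->
       at_most_many c (fun w => P w /\ flips Ns q T w)) ->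
  at_most_many (reach l * c) (fun w => P w /\ flips (N :: Ns) y T w).
Proof.
move=> PN yl yT ins; have [p Hp] : exists p : seq (config N), accepting_path
  (single_oracle (system_at Ns T)) y p by move: yT; rewrite inE.
have [sz lq] := accepting_path_bounds PN yl Hp.
apply: (@at_most_many_le _ (size (asked y p tt) * c)).
  by rewrite leq_mul2r sz orbT.
apply: (@at_most_many_sub _ _ _ (fun w => exists2 q, q \in asked y p tt &
    P w /\ flips Ns q T w)); last first.
  by apply: at_most_many_has => q /lq; apply: ins.
move=> w [Pw fl]; apply: contrapT => N'; move: fl; rewrite /flips yT eqb_id.
case/negP; rewrite inE; exists p; rewrite -/(system_language _ _).
change (accepting_path (single_oracle (system_at Ns (w :: T))) y p).
by rewrite accepting_path_flips // => -[q Hq fl]; apply: N'; exists q.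
Qed.

Lemma legal_cons x T :
    legal T -> F x.1 -> in_block h x.1 x ->
    load x.1 T < h ->
  legal (x :: T).
Proof.
move=> [aT cT] Fx bx cx; split=> [|m]; first by rewrite /= Fx bx aT.
rewrite /load /= -/(load m T); have := cT m.
have [<- _|_] := eqVneq x.1 m; last by rewrite add0n.
by rewrite add1n.
Qed.

(** A yes is stable by [negative_flips]; a no that is too often turned into a yes contradicts
    unambiguity by [ambiguity]. Each level uses up one unit of room: the levels below are considered
    after the addition of one element to the same block. At least one level also leaves room for the
    pair [z], [w]. *)
Lemma insensitivity Ns l T m y :
    polytime_exp_all Ns ->
    (forall U, legal U -> unambiguous_upto (oracle_at U) Ns l) ->
    legal T -> F m -> load m T + size Ns < h ->
    size y <= l ->
  at_most_many (sensitivity (size Ns) l) (fun x => in_block h m x /\ flips Ns y T x).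
Proof.
elim: Ns l T m y => [|N Ns IHNs] l T m y.
  move=> _ _ _ _ _ _; have [zs /andP[zh _] loc] := oracle_local h y.
  move=> s us Hs; apply: leq_trans zh; apply: uniq_leq_size => // x /Hs[_ fl].
  apply: contraLR fl => xzs; rewrite negbK; apply/eqP; apply: loc => z zzs /=.
  by rewrite inE; case: eqP zzs xzs => [-> ->|].
move=> /= [PN PNs] un lT Fm room yl.
have un' U : legal U -> unambiguous_upto (oracle_at U) Ns (reach l) by case/un.
set c := sensitivity (size Ns) (reach l).
set K := 2 * _.
have ins U : legal U -> load m U + size Ns < h ->
    forall q, size q <= reach l ->
    at_most_many c (fun x => in_block h m x /\ flips Ns q U x).
  by move=> lU rU q; apply: IHNs.
have [yT|nyT] := boolP (y \in system_at (N :: Ns) T).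
  apply: (@at_most_many_le _ (reach l * c)); last first.
    by apply: negative_flips => //; apply: ins => //; lia.
  by rewrite /K /= -/c; move: (reach l * c) => a; rewrite expnS expn1; nia.
move=> s us Hs; rewrite leqNgt; apply/negP => Ks.
have blk x : x \in s -> in_block h m x by case/Hs.
have lx x : x \in s -> x.1 = m by move/blk=> /and3P[/eqP].
have lU x : x \in s -> legal (x :: T).
  by move=> xs; apply: legal_cons; rewrite ?(lx x xs) ?blk //; lia.
have pos x : x \in s -> y \in system_at (N :: Ns) (x :: T).
  by case/Hs=> _; rewrite /flips (negbTE nyT) eqbF_neg negbK.
(* The cut at [K.+1] makes the first part exceed [K] and leaves more than [K.+1 * K] elements in the
   second. *)
have sub1 x : x \in take K.+1 s -> x \in s by apply: mem_take.
have sub2 x : x \in drop K.+1 s -> x \in s by apply: mem_drop.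
have Ks1 : K < size s by move: Ks; rewrite expnS expn1; nia.
apply: (@ambiguity N Ns l c T y (take K.+1 s) (drop K.+1 s)) => //.
- by move=> z /sub1 /pos.
- by move=> z /sub2 /pos.
- move=> q ql; apply: at_most_many_sub (ins T lT _ q ql); last lia.
  by move=> x [/sub2 /blk bx fl].
- move=> z /sub1 zs q ql; apply: at_most_many_sub (ins (z :: T) (lU z zs) _ q ql).
    by move=> x [/sub2 /blk bx fl].
  by rewrite /load /= (lx z zs) eqxx -/(load m T); lia.
- move=> z /sub2 zs q ql; apply: at_most_many_sub (ins (z :: T) (lU z zs) _ q ql).
    by move=> x [/sub1 /blk bx fl].
  by rewrite /load /= (lx z zs) eqxx -/(load m T); lia.
- move=> z w /sub1 zs /sub2 ws.
  have [|H _] := un (z :: w :: T); last exact: H.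
  apply: legal_cons; rewrite ?(lx z zs) ?blk //; first exact: lU.
  rewrite /load /= (lx w ws) eqxx -/(load m T); lia.
- exact: take_uniq.
- exact: drop_uniq.
- by rewrite size_takel.
- rewrite size_takel // size_drop; move: Ks; rewrite /= -/c -/K.
  by rewrite expnS expn1; nia.
Qed.

End Insensitivity.

(** * Bounded queries against many blocks *)

Lemma not_at_most_many (T : eqType) c (P : T -> Prop) :
  ~ at_most_many c P ->
  exists s, [/\ uniq s, {in s, forall x, P x} & c < size s].
Proof.
move=> N; apply: contrapT => N'; apply: N => s us Hs.
by rewrite leqNgt; apply/negP => cs; apply: N'; exists s.
Qed.

Section Blocks.
Variables (h e : nat) (B0 : set elt) (F : pred nat) (M : otm bool)
  (Ns : seq (otm unit)) (x : word) (k : nat).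

Let l := size x.
(** Formally the bound of [insensitivity] for [h] levels, which an empty block has not enough room
    to justify. What is used is its form [K.+1 * K.+1], with [K] computed from the [h - 1] lower
    levels. *)
Let S := sensitivity h e h (reach e l).
Let oracles (T : seq elt) : bool -> language :=
  double_oracle (oracle_at h B0 T) (system_at h B0 Ns T).

(** If no question on the halting computation changes its answer, determinism forces the same
    computation and the same verdict. A question to the base oracle counts as one to the system
    without machines. *)
Lemma changed_answer z p :
    deterministic M -> computation (oracles [::]) x p ->
    halted (last (init M x) p) ->
    x \notin accepted M (oracles [::]) -> x \in accepted M (oracles [:: z]) ->
  (exists2 q, q \in asked x p false & flips h B0 [::] q [::] z) \/
  (exists2 q, q \in asked x p true & flips h B0 Ns q [::] z).
Proof.
move=> D Hp hp nx xz; apply: contrapT => N.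
have E : computation (oracles [:: z]) x p = computation (oracles [::]) x p.
  apply: computation_asked => -[] q Hq; apply/eqP/negPn/negP => fl; apply: N.
    by right; exists q.
  by left; exists q.
have Hp' : computation (oracles [:: z]) x p by rewrite E.
move: xz; rewrite inE => -[p' /and3P[Hc hh ac]].
have [r Er] := deterministic_prefix D Hp' Hc hh.
case: r Er => [|c r] Er.
  rewrite cats0 in Er; case/negP: nx; rewrite inE; exists p.
  by rewrite /accepting_path Hp hp -Er.
move: Hc; rewrite Er /computation cat_path /= => /and3P[_ s _].
by case/negP: (halted_no_step (oracles [:: z]) c hp).
Qed.

(** The top level is handled by [ambiguity] across two blocks: neither family then takes room from
    the block of the other, which saves the one element that [insensitivity] lacks for [h]
    levels. *)
Theorem blocks_contradiction (bl : 'I_k.+1 -> nat) :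
    deterministic M -> polytime_exp M e -> polytime_exp_all e Ns ->
    size Ns = h -> 0 < h ->
    (forall U, legal h F U ->
       unambiguous_upto e (oracle_at h B0 U) Ns (reach e l)) ->
    x \notin accepted M (oracles [::]) ->
    (forall z, legal h F [:: z] -> x \in accepted M (oracles [:: z])) ->
    (forall p : seq (config M), computation (oracles [::]) x p ->
       queries true x p <= k) ->
    injective bl -> (forall i, F (bl i)) ->
    (forall i, ~ at_most_many (reach e l * h + k * S) (in_block h (bl i))) ->
  False.
Proof.
move=> D PM PNs sNs h0 un nx xz qk bl_inj Fbl big.
have [p Hp hp] := longest_computation (oracles [::]) x PM.
have legal0 : legal h F [::] by [].
have legal1 i z : in_block h (bl i) z -> legal h F [:: z].
  move=> bz; have Ez : z.1 = bl i by case/and3P: bz => /eqP.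
  by apply: legal_cons; rewrite ?Ez.
have [sA lA] := asked_bounds false PM (leqnn _) Hp.
have [_ lD] := asked_bounds true PM (leqnn _) Hp.
have kD : size (asked x p true) <= k by rewrite size_asked; apply: qk.
have [N [Ns' ENs]] : exists N Ns', Ns = N :: Ns'.
  by case: (Ns) sNs => [|N Ns'] E; [move: h0; rewrite -E|exists N, Ns'].
move: PNs; rewrite ENs => -[PN PNs'].
have sNs' : h = (size Ns').+1 by rewrite -sNs ENs.
set c := sensitivity h e (size Ns') (reach e (reach e l)).
set K := 2 * (reach e (reach e l) * c).
have ES : S = K.+1 * K.+1 by rewrite /S {2}sNs' /= expnS expn1.
have un' U : legal h F U ->
    unambiguous_upto e (oracle_at h B0 U) Ns' (reach e (reach e l)).
  by move=> lU; have := un U lU; rewrite ENs => -[].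
(* For the [h - 1] lower levels the room condition [0 + (h - 1) < h] just holds, even when [T] has
   an element in another block. *)
have ins T i q : legal h F T -> load (bl i) T = 0 ->
    size q <= reach e (reach e l) ->
    at_most_many c (fun z => in_block h (bl i) z /\ flips h B0 Ns' q T z).
  move=> lT rT lq; apply: (@insensitivity h e B0 F) => //.
  by rewrite rT add0n sNs'.
(* Every element of the block changes some answer. A question to the base oracle accounts for at
   most [h] elements, a question to the system answered yes for at most [S]; the block is too large
   unless some question answered no accounts for more than [S]. *)
have /choice[q Hq] i : exists q, [/\ q \in asked x p true,
    q \notin system_at h B0 Ns [::] &
    ~ at_most_many S (fun z => in_block h (bl i) z /\ flips h B0 Ns q [::] z)].
  apply: contrapT => NN; apply: (big i).
  apply: (@at_most_many_le _ (size (asked x p false) * h + size (asked x p true) * S)).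
    by rewrite leq_add // leq_mul2r ?sA ?kD orbT.
  apply: (@at_most_many_sub _ _ _ (fun z =>
     (exists2 q, q \in asked x p false & in_block h (bl i) z /\ flips h B0 [::] q [::] z) \/
     (exists2 q, q \in asked x p true & in_block h (bl i) z /\ flips h B0 Ns q [::] z))).
    move=> z bz; have := changed_answer D Hp hp nx (xz z (legal1 i z bz)).
    by case=> -[r Hr fl]; [left|right]; exists r.
  apply: at_most_many_or; apply: at_most_many_has => r Hr.
    apply: (@insensitivity h e B0 F [::] (reach e l)) => //; rewrite ?addn0 //.
    exact: lA.
  have [rD|rD] := boolP (r \in system_at h B0 Ns [::]); last first.
    by apply: contrapT => NS; apply: NN; exists r.
  apply: (@at_most_many_le _ (reach e (reach e l) * c)).
    by rewrite ES /K; move: (_ * c) => a; nia.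
  move: rD; rewrite ENs => rD; apply: (negative_flips PN _ rD).
    exact: lD.
  by move=> q; apply: ins.
(* Pigeonhole: [k + 1] blocks, at most [k] questions to the system. *)
have [i [j [ij qij]]] : exists i j, i != j /\ q i = q j.
  apply: contrapT => NN.
  have : size [seq q i | i <- enum 'I_k.+1] <= size (asked x p true).
    apply: uniq_leq_size => [|_ /mapP[i _ ->]]; last by have [] := Hq i.
    rewrite map_inj_uniq ?enum_uniq // => i j qij; apply/eqP; apply: contrapT => ij.
    by apply: NN; exists i, j; split=> //; apply/negP.
  by rewrite size_map size_enum_ord; lia.
have [qp nq /not_at_most_many[s1 [u1 H1 b1]]] := Hq i.
have [_ _ /not_at_most_many[s2 [u2 H2 b2]]] := Hq j.
rewrite -qij in H2; rewrite ENs in nq H1 H2.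
have sub1 z : z \in take K.+1 s1 -> z \in s1 by apply: mem_take.
have B1 z : z \in take K.+1 s1 -> in_block h (bl i) z by case/sub1/H1.
have B2 z : z \in s2 -> in_block h (bl j) z by case/H2.
have load0 a b z : a != b -> in_block h (bl a) z -> load (bl b) [:: z] = 0.
  move=> ab /and3P[/eqP Ez _ _]; rewrite /load /= Ez (inj_eq bl_inj).
  by rewrite (negbTE ab).
have K1 : K.+1 <= size s1 by rewrite ES in b1; nia.
apply: (@ambiguity h e B0 N Ns' (reach e l) c [::] (q i) (take K.+1 s1) s2) => //.
- exact: lD.
- by move=> z /sub1 /H1[_]; rewrite /flips (negbTE nq) eqbF_neg negbK.
- by move=> z /H2[_]; rewrite /flips (negbTE nq) eqbF_neg negbK.
- move=> r lr; apply: at_most_many_sub (ins [::] j r legal0 _ lr) => //.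
  by move=> z [/B2].
- move=> z /B1 bz r lr.
  apply: at_most_many_sub (ins [:: z] j r (legal1 i z bz) (load0 i j z ij bz) lr).
  by move=> w [/B2].
- move=> w /B2 bw r lr; rewrite eq_sym in ij.
  apply: at_most_many_sub (ins [:: w] i r (legal1 j w bw) (load0 j i w ij bw) lr).
  by move=> z [/B1].
- move=> z w /B1 bz /B2 bw.
  have Ez : z.1 = bl i by case/and3P: bz => /eqP.
  have lzw : legal h F [:: z; w].
    apply: legal_cons; rewrite ?Ez //; first exact: legal1 bw.
    by rewrite (load0 j i w _ bw) // eq_sym.
  have := un _ lzw; rewrite ENs => -[H _]; apply: H; exact: lD.
- exact: take_uniq.
- by rewrite size_takel.
- by rewrite size_takel // -/K; rewrite ES in b2; nia.
Qed.

End Blocks.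

(** * The generic oracle *)

(** For [n = h * 2 ^ a + h.+2] the division in [chunk] is exact and gives [2 ^ a], while
    [(n + 2) ^ e] is at most [2 ^ ((h + 5 + a) * e)]. With [a = 2 * b] and [b] above [(h + 5) * e],
    the square of [2 ^ b] exceeds this exponent. *)
Lemma poly_lt_exp_chunk h f N :
  0 < h -> poly_bounded f -> exists2 n, N < n & f n < 2 ^ chunk h n.
Proof.
move=> h0 [e fe].
have [b Eb] : {b | b = (h + 5) * e + N + 1} by eexists.
have [a Ea] : {a | a = 2 * b} by eexists.
exists (h * 2 ^ a + h.+2).
  have aN : N < a by lia.
  have : a < 2 ^ a by apply: ltn_expl.
  by have := leq_pmull (2 ^ a) h0; move: (2 ^ a) => u; clear -aN; lia.
rewrite /chunk addnK mulKn //; apply: leq_ltn_trans (fe _) _.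
have H : (h * 2 ^ a + h.+2).+2 <= 2 ^ (h + 5 + a).
  rewrite expnD (addnS h 4) expnS; have : h + 4 < 2 ^ (h + 4) by apply: ltn_expl.
  have : 0 < 2 ^ a by rewrite expn_gt0.
  by move: (2 ^ a) (2 ^ _) => u v; nia.
apply: (@leq_ltn_trans ((2 ^ (h + 5 + a)) ^ e)).
  by case: (e) => [|d]; rewrite ?expn0 ?leq_exp2r.
rewrite -expnM ltn_exp2l //; rewrite {2}Ea expnM.
have : b < 2 ^ b by apply: ltn_expl.
have -> : (2 ^ 2) ^ b = 2 ^ b * 2 ^ b by rewrite -expnM mul2n -addnn expnD.
by move: (2 ^ b) => u; nia.
Qed.

Lemma leq_iter (f : nat -> nat) i l : (forall n, n <= f n) -> l <= iter i f l.
Proof. by move=> ff; elim: i => //= i /leq_trans; apply. Qed.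

Lemma reach_poly e : poly_bounded (reach e).
Proof.
apply: poly_bounded_add (poly_bounded_const 1).
apply: poly_bounded_add poly_bounded_id _.
exact: poly_bounded_add (poly_bounded_exp e) (poly_bounded_const e).
Qed.

Lemma sensitivity_poly h e j : poly_bounded (sensitivity h e j).
Proof.
elim: j => [|j IHj] /=; first exact: poly_bounded_const.
apply: (poly_bounded_comp (poly_bounded_exp 2)).
apply: (@poly_bounded_le _ (fun n => 2 * (reach e n * sensitivity h e j (reach e n)) + 1)).
  by move=> n; rewrite addn1.
apply: poly_bounded_add (poly_bounded_const 1).
apply: poly_bounded_mul (poly_bounded_const 2) _.
apply: poly_bounded_mul (reach_poly e) _.
exact: poly_bounded_comp IHj (reach_poly e).
Qed.

(** Each level may stretch the length [l] of its input to questions of length [reach e l], so the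
    base oracle is seen only up to the iterate of [reach e] over all levels. *)
Lemma system_language_local e Ns A A' l y :
    polytime_exp_all e Ns ->
    (forall w, size w <= iter (size Ns) (reach e) l -> (w \in A) = (w \in A')) ->
    size y <= l ->
  (y \in system_language A Ns) = (y \in system_language A' Ns).
Proof.
elim: Ns l y => [|N Ns IHNs] l y; first by move=> _ H /H.
rewrite [size _]/= iterSr => -[PN PNs] H yl.
have loc p O : accepting_path O y p ->
    accepting_path (single_oracle (system_language A Ns)) y p =
    accepting_path (M := N) (single_oracle (system_language A' Ns)) y p.
  move=> Hp; have [_ lq] := accepting_path_bounds PN yl Hp.
  by apply: accepting_path_asked => -[] q /lq; apply: IHNs.
apply/idP/idP; rewrite !inE => -[p Hp]; exists p.
  by rewrite -(loc _ _ Hp).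
by rewrite (loc _ _ Hp).
Qed.

Lemma unambiguous_local e Ns A A' l :
    polytime_exp_all e Ns ->
    (forall w, size w <= iter (size Ns) (reach e) l -> (w \in A) = (w \in A')) ->
  unambiguous A Ns -> unambiguous_upto e A' Ns l.
Proof.
elim: Ns l => //= N Ns IHNs l [PN PNs]; rewrite -iterS iterSr => H [uN uNs].
split; last exact: IHNs.
move=> y yl ps ups aps; apply: (uN y) => //; apply: sub_all aps => p Hp.
have [_ lq] := accepting_path_bounds PN yl Hp.
rewrite (accepting_path_asked (O' := single_oracle (system_language A' Ns))) //.
by case=> q /lq; exact: system_language_local PNs H.
Qed.

Lemma accepted_local e (M : otm bool) Ns A A' x :
    polytime_exp M e -> polytime_exp_all e Ns ->
    (forall w, size w <= iter (size Ns) (reach e) (reach e (size x)) ->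
       (w \in A) = (w \in A')) ->
  forall p, computation (double_oracle A (system_language A Ns)) x p =
    computation (M := M) (double_oracle A' (system_language A' Ns)) x p /\
  accepting_path (double_oracle A (system_language A Ns)) x p =
    accepting_path (M := M) (double_oracle A' (system_language A' Ns)) x p.
Proof.
move=> PM PNs H p.
have loc O : computation O x p -> forall i w, w \in asked x p i ->
    (w \in double_oracle A (system_language A Ns) i) =
    (w \in double_oracle A' (system_language A' Ns) i).
  move=> Hp i w Hw; have [_ lq] := asked_bounds i PM (leqnn _) Hp.
  have wl := lq w Hw; case: i {Hw lq}; first exact: system_language_local PNs H wl.
  apply: H; apply: leq_trans wl _; apply: leq_iter => n.
  by rewrite /reach; lia.
have E : computation (double_oracle A (system_language A Ns)) x p =
    computation (double_oracle A' (system_language A' Ns)) x p.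
  by apply/idP/idP => Hp; move: (Hp); rewrite (computation_asked (loc _ Hp)).
by split=> //; rewrite /accepting_path E.
Qed.

Section Generic.
Variables (h : nat) (k : nat -> nat).
Hypotheses (h_gt0 : 0 < h) (k_poly : poly_bounded k).

(** The verdict of the list reduction on [1^n]. *)
Definition hit (B : set elt) (n : nat) : Prop :=
  exists2 x, B x & n <= x.1 <= n + k n.

(** The number is a common time exponent of all machines; fixing it in advance provides the concrete
    bounds from which [density] chooses the input length. *)
Definition requirement : Type := (otm_code bool * seq (otm_code unit) * nat)%type.

(** Unambiguity and the bound on the questions belong to success at [B]: a candidate that violates
    them is defeated as well. Length 0 is left out because the witness languages contain only words
    ending in 1. *)
Definition succeeds (B : set elt) (u : requirement) : Prop :=
  let M := otm_of_code u.1.1 in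
  let Ns := [seq otm_of_code v | v <- u.1.2] in
  let O := double_oracle (oracle h B) (system_language (oracle h B) Ns) in
  [/\ deterministic M, polytime_exp M u.2, size Ns = h & polytime_exp_all u.2 Ns] /\
  [/\ unambiguous (oracle h B) Ns,
      forall x (p : seq (config M)), computation O x p ->
        queries true x p <= k (size x) &
      forall n, 0 < n -> nseq n true \in accepted M O <-> hit B n].

(** Conditions as in Cohen forcing: a finite set together with the length below which it is
    final. *)
Definition condition : Type := (seq elt * nat)%type.

Definition valid (c : condition) : Prop :=
  promise h [set x | x \in c.1] /\ all (fun x => x.1 < c.2) c.1.

Definition extends (c c' : condition) : Prop :=
  c.2 <= c'.2 /\ forall x, x.1 < c.2 -> (x \in c'.1) = (x \in c.1).

Definition agrees (B : set elt) (c : condition) : Prop :=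
  forall x, x.1 < c.2 -> B x <-> x \in c.1.

Lemma oracle_agrees B (c : condition) w :
  agrees B c -> size w < c.2 -> (w \in oracle h [set x | x \in c.1]) = (w \in oracle h B).
Proof.
move=> Bc wc; have [zs /andP[_ /allP zw] loc] := oracle_local h w.
apply: loc => x /zw /eqP xw; rewrite /=; split; last by move/Bc; apply; rewrite xw.
by move=> xc; apply/Bc; rewrite // xw.
Qed.

Lemma legal_valid (c : condition) n m T :
    valid c -> c.2 <= n -> n + k n < m ->
    legal h (fun m => n <= m <= n + k n) T ->
  valid (c.1 ++ T, m) /\ extends c (c.1 ++ T, m).
Proof.
move=> [[pb pc] bc] cn nm [/allP aT lT].
have Tge (x : elt) : x \in T -> n <= x.1 <= n + k n by move/aT/andP=> [].
have clt (x : elt) : x \in c.1 -> x.1 < c.2 by apply: (allP bc).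
split; [split; [split|]|split=> /=].
- move=> x /=; rewrite mem_cat => /orP[/pb //|/aT /andP[_]//].
- move=> i s us Hs; have [ni|ni] := leqP n i.
    apply: leq_trans (lT i); rewrite /load -size_filter; apply: uniq_leq_size => // x.
    move=> /Hs[/=]; rewrite mem_cat mem_filter => + xi; rewrite xi eqxx.
    by case/orP=> // /clt; rewrite xi; lia.
  apply: (pc i) => // x /Hs[/= xcT xi]; split=> //; move: xcT.
  by rewrite /= mem_cat => /orP[//|/Tge]; rewrite xi; lia.
- apply/allP => x /=; rewrite mem_cat => /orP[/clt|/Tge]; lia.
- lia.
- move=> x xc; rewrite mem_cat; case xT: (x \in T); last by rewrite orbF.
  have /andP[nx _] := Tge x xT.
  by have := leq_trans (leq_trans xc cn) nx; rewrite ltnn.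
Qed.

(** If no extension defeats [u], then for every legal [T] the extension by [T] agrees with a set at
    which [u] succeeds. Transferred back to [T], these successes are the hypotheses of
    [blocks_contradiction]. *)
Lemma density u (c : condition) : valid c ->
  exists c', [/\ valid c', extends c c' &
    forall B, promise h B -> agrees B c' -> ~ succeeds B u].
Proof.
move=> vc; apply: contrapT => N.
have {}N c' : valid c' -> extends c c' ->
    exists2 B, promise h B /\ agrees B c' & succeeds B u.
  move=> vc' ec; apply: contrapT => N'; apply: N; exists c'; split=> // B pB aB sB.
  by apply: N'; exists B.
set M := otm_of_code u.1.1; set Ns := [seq otm_of_code v | v <- u.1.2].
set e := u.2.
have [n cn nbig] : exists2 n, c.2 < n & reach e n * h + k n *
    sensitivity h e h (reach e n) + 1 < 2 ^ chunk h n.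
  apply: (poly_lt_exp_chunk (f := fun n => reach e n * h + k n *
    sensitivity h e h (reach e n) + 1)) => //.
  apply: poly_bounded_add (poly_bounded_const 1).
  apply: poly_bounded_add.
    exact: poly_bounded_mul (reach_poly e) (poly_bounded_const h).
  apply: poly_bounded_mul k_poly _.
  exact: poly_bounded_comp (sensitivity_poly h e h) (reach_poly e).
(* Beyond all blocks of the list and beyond every word of the base oracle that matters on [1^n]: the
   reduction asks up to length [reach e n], and the [h] levels iterate from there. *)
pose m := (iter h (reach e) (reach e n) + (n + k n)).+1.
pose F := fun i => n <= i <= n + k n.
pose B0 : set elt := [set x | x \in c.1].
pose oracles T := double_oracle (oracle_at h B0 T) (system_at h B0 Ns T).
have facts T : legal h F T ->
  [/\ deterministic M, polytime_exp M e, size Ns = h & polytime_exp_all e Ns] /\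
  [/\ unambiguous_upto e (oracle_at h B0 T) Ns (reach e n),
      forall p : seq (config M), computation (oracles T) (nseq n true) p ->
        queries true (nseq n true) p <= k n &
      nseq n true \in accepted M (oracles T) <-> exists x, x \in T].
  move=> lT.
  have [vT eT] : valid (c.1 ++ T, m) /\ extends c (c.1 ++ T, m).
    by apply: legal_valid lT => //; rewrite /m; lia.
  have [B [pB aB] [[D PM sNs PNs] [un qk acc]]] := N _ vT eT.
  rewrite -/M -/Ns -/e in D PM sNs PNs un qk acc.
  have loc w : size w <= iter h (reach e) (reach e n) ->
      (w \in oracle h B) = (w \in oracle_at h B0 T).
    move=> wm; rewrite -(oracle_agrees aB); last by rewrite /m /=; lia.
    rewrite /oracle_at; congr (_ \in oracle h _).
    by apply/seteqP; split=> x /=; rewrite /B0 /= mem_cat => /orP.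
  have loc' := @accepted_local e M Ns (oracle h B) (oracle_at h B0 T) (nseq n true) PM PNs.
  rewrite size_nseq sNs in loc'; have {}loc' := loc' loc.
  split=> //; split.
  - by apply: (unambiguous_local PNs _ un); rewrite sNs.
  - move=> p Hp; have := qk (nseq n true) p; rewrite size_nseq; apply.
    by rewrite (loc' p).1.
  - have n0 : 0 < n by lia.
    have Eacc : nseq n true \in accepted M (oracles T) <-> hit B n.
      rewrite -(acc n n0) !inE; split=> -[p Hp]; exists p.
        by rewrite (loc' p).2.
      by rewrite -(loc' p).2.
    rewrite Eacc; split=> [[x Bx xn]|[x xT]].
      move: Bx; rewrite (aB x) /=; last by rewrite /m; lia.
      rewrite mem_cat => /orP[xc|]; last by exists x.
      by have /= := allP vc.2 x xc; lia.
    have Fx : n <= x.1 <= n + k n by case: lT => /allP /(_ x xT) /andP[].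
    exists x => //; apply/aB => /=; last by rewrite mem_cat xT orbT.
    by case/andP: Fx => _ /leq_ltn_trans; apply; rewrite /m; lia.
have [[D PM sNs PNs] [_ qk empty]] : _ := facts [::] (conj isT (fun=> leq0n h)).
apply: (@blocks_contradiction h e B0 F M Ns (nseq n true) (k n) (fun i => n + i)) => //.
- by move=> U /facts[_ []]; rewrite size_nseq.
- by apply/negP => /empty[].
- by move=> z /facts[_ [_ _ ->]]; exists z; rewrite mem_head.
- by move=> i j /addnI /val_inj.
- by move=> i; rewrite /F; have := ltn_ord i; lia.
move=> i; rewrite size_nseq => few.
have gi : chunk h n <= chunk h (n + i) by rewrite /chunk leq_div2r //; lia.
have g0 : 0 < chunk h n.
  by rewrite lt0n; apply/eqP => g0; move: nbig; rewrite g0; lia.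
have : size [seq ((n + i)%N, z) | z <- pool (chunk h (n + i))] <=
    reach e n * h + k n * sensitivity h e h (reach e n).
  apply: few => [|x /mapP[z + ->]].
    by rewrite map_inj_uniq ?pool_uniq // => a b [].
  rewrite mem_pool /in_block /= eqxx /= => ->; rewrite andbT; lia.
rewrite size_map size_pool.
have : 2 ^ chunk h n <= 2 ^ chunk h (n + i) by rewrite leq_exp2l.
lia.
Qed.

(** The usual generic construction: stage [s] extends the condition so as to defeat the requirement
    with code [s], if there is one, and [B] is the union. *)
Lemma generic_set : exists2 B, promise h B & forall u, ~ succeeds B u.
Proof.
have /choice[ext Hext] (uc : requirement * condition) : exists c', valid uc.2 ->
    [/\ valid c', extends uc.2 c' &
      forall B, promise h B -> agrees B c' -> ~ succeeds B uc.1].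
  have [vc|nvc] := pselect (valid uc.2); last by exists uc.2.
  by have [c' Hc'] := density uc.1 vc; exists c'.
pose next s c := if @unpickle requirement s is Some u then ext (u, c) else c.
pose cs := fix cs s := if s is s'.+1 then next s' (cs s') else ([::], 0).
have cs_valid s : valid (cs s).
  elim: s => [|s IHs] /=; first by split=> //; split=> // m [|x s] // _ /(_ x (mem_head _ _))[].
  by rewrite /next; case: unpickle => // u; have [] := Hext (u, cs s) IHs.
have cs_ext s : extends (cs s) (cs s.+1).
  rewrite /= /next; case: unpickle => [u|]; last by split.
  by have [] := Hext (u, cs s) (cs_valid s).
have cs_mono s t : s <= t -> extends (cs s) (cs t).
  move/subnKC <-; elim: (t - s) => [|d [IH1 IH2]]; first by rewrite addn0; split.
  rewrite addnS; have [H1 H2] := cs_ext (s + d); split; first exact: leq_trans H1.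
  by move=> x xs; rewrite H2 ?IH2 //; apply: leq_trans IH1.
have cs_sub s t x : s <= t -> x \in (cs s).1 -> x \in (cs t).1.
  move=> st xs; rewrite (cs_mono s t st).2 //.
  exact: (allP (cs_valid s).2).
pose B : set elt := [set x | exists s, x \in (cs s).1].
have BA s : agrees B (cs s).
  move=> x xs; split=> [[t xt]|]; last by exists s.
  have [st|ts] := leqP s t; last by apply: cs_sub xt; apply: ltnW.
  by rewrite -(cs_mono s t st).2.
have pB : promise h B.
  split=> [x [s xs]|m s us Hs]; first exact: (cs_valid s).1.1.
  (* The promise concerns finite lists, and a finite part of [B] is already present at one stage. *)
  have [t Ht] : exists t, {in s, forall x, x \in (cs t).1}.
    elim: s us Hs => [|x s IHs] /=; first by exists 0.
    case/andP=> _ us Hs; have [|t Ht] := IHs us.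
      by move=> y ys; apply: Hs; rewrite inE ys orbT.
    have [[t' xt'] _] := Hs x (mem_head _ _); exists (maxn t t') => y.
    rewrite inE => /predU1P[->|/Ht]; last exact: cs_sub (leq_maxl _ _).
    exact: cs_sub (leq_maxr _ _) xt'.
  apply: ((cs_valid t).1.2 m) => // x xs; split; first exact: Ht.
  by case: (Hs x xs).
have next_pickle u c : next (pickle u) c = ext (u, c) by rewrite /next pickleK.
have cs_next s : cs s.+1 = next s (cs s) by [].
exists B => // u; have [_ _] := Hext (u, cs (pickle u)) (cs_valid _).
by apply=> //; rewrite -next_pickle -cs_next; exact: BA.
Qed.

Lemma polytime_systemP Ns :
  polytime_system Ns -> exists e, polytime_exp_all e Ns.
Proof.
elim: Ns => [|N Ns IHNs] /=; first by exists 0.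
case=> -[e He] /IHNs[e' He']; exists (maxn e e'); split.
  exact: polytime_exp_le (leq_maxl _ _) He.
elim: Ns He' {IHNs} => //= N' Ns IHNs [H1 H2]; split; last exact: IHNs.
exact: polytime_exp_le (leq_maxr _ _) H1.
Qed.

Lemma polytime_exp_all_le e e' Ns :
  e <= e' -> polytime_exp_all e Ns -> polytime_exp_all e' Ns.
Proof.
move=> ee; elim: Ns => //= N Ns IHNs [H1 H2]; split; last exact: IHNs.
exact: polytime_exp_le ee H1.
Qed.

(** The tail is recoded with its language unchanged, so the first machine keeps its oracle and its
    unambiguity passes through the isomorphism. *)
Lemma code_system e Ns A : polytime_exp_all e Ns -> unambiguous A Ns ->
  exists us : seq (otm_code unit), let Ns' := [seq otm_of_code u | u <- us] in
    [/\ size Ns' = size Ns, polytime_exp_all e Ns', unambiguous A Ns' &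
        system_language A Ns' = system_language A Ns].
Proof.
elim: Ns => [|N Ns IHNs] /=; first by exists [::].
case=> PN PNs [uN uNs]; have [us [sus Pus uus Lus]] := IHNs PNs uNs.
have [u [E]] := otm_of_code_surj N; exists (u :: us) => /=; split.
- by rewrite sus.
- by split=> //; apply: iso_polytime_exp E e PN.
- by split=> // y; rewrite Lus; apply: iso_at_most E 1 _ y (uN y).
- by rewrite Lus -(iso_accepted E).
Qed.

Theorem generic_oracle : exists2 B, promise h B &
  forall L, turing_reducible k (oracle h B) (USigma h (oracle h B)) L ->
    exists2 n, 0 < n & ~ (L (nseq n true) <-> hit B n).
Proof.
have [B pB HB] := generic_set; exists B => // L.
case=> _ [Ns [sNs PNs uNs ->]] [M [D [e PM] qk ->]].
have [e' PNs'] := polytime_systemP PNs.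
have [us [sus Pus uus Lus]] := code_system PNs' uNs.
have [u [E]] := otm_of_code_surj M.
apply: contrapT => N; apply: (HB (u, us, maxn e e')); split; split=> //=.
- exact: iso_deterministic E D.
- apply: iso_polytime_exp E _ _; exact: polytime_exp_le (leq_maxl _ _) PM.
- by rewrite sus.
- exact: polytime_exp_all_le (leq_maxr _ _) Pus.
- move=> x p; rewrite Lus -(iso_computation (otm_iso_sym E)) => /qk.
  by rewrite iso_queries.
- move=> n n0; rewrite Lus -(iso_accepted E) inE; apply: contrapT => nL.
  by apply: N; exists n.
Qed.

End Generic.

(** * Tapes holding a word *)

Definition move (d : option bool) (i : nat) : nat :=
  match d with Some true => i.+1 | Some false => i.-1 | None => i end.

(** Cells are compared one by one with blank as default: rewriting a blank beyond the end pads the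
    list without changing the tape. *)
Definition tape_is (I : finType) (M : otm I) (tc : tape_content M)
    (w : word) (i : nat) : Prop :=
  (forall j, nth None tc.1 j = nth None [seq Some (inl b) | b <- w] j) /\ tc.2 = i.

Section Tapes.
Context {I : finType} {M : otm I}.
Implicit Types (tc : tape_content M) (s : seq (cell M)).

Lemma tape_is_scan tc w i : tape_is tc w i ->
  nth None tc.1 tc.2 = if i < size w then Some (inl (nth false w i)) else None.
Proof.
case=> H ->; rewrite H; case: ltnP => iw; last by rewrite nth_default ?size_map.
by rewrite (nth_map false).
Qed.

Lemma bits_of_map w : bits_of [seq (Some (inl b) : cell M) | b <- w] = w.
Proof. by elim: w => //= b w ->. Qed.

Lemma bits_of_nth s s' :
  (forall j, nth None s j = nth None s' j) -> bits_of s = bits_of s'.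
Proof.
elim: s s' => [|u s IHs] [|u' s'] // H.
- by have /= := H 0; case: u' H => // -[].
- by have /= := H 0; case: u H => // -[].
- have /= <- := H 0; rewrite (IHs s') // => j; exact: (H j.+1).
Qed.

Lemma tape_is_bits tc w i : tape_is tc w i -> bits_of tc.1 = w.
Proof. by case=> /bits_of_nth -> _; rewrite bits_of_map. Qed.

Lemma set_nth_same s i j : nth None (set_nth None s i (nth None s i)) j = nth None s j.
Proof. by rewrite nth_set_nth /=; case: eqP => [->|]. Qed.

Lemma tape_is_keep tc w i d :
  tape_is tc w i -> tape_is (act (nth None tc.1 tc.2, d) tc) w (move d i).
Proof.
case=> H E; split=> [j|] /=; first by rewrite set_nth_same.
by rewrite E; case: d => [[]|].
Qed.

Lemma tape_is_write tc w i b d :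
  tape_is tc w i -> i <= size w ->
  tape_is (act (Some (inl b), d) tc) (set_nth false w i b) (move d i).
Proof.
case=> H E iw; split=> [j|] /=; last by rewrite E; case: d => [[]|].
rewrite nth_set_nth /= E H.
have [jw|jw] := ltnP j (size (set_nth false w i b)).
  rewrite [RHS](nth_map false) // nth_set_nth /=; case: eqP => // ji.
  rewrite (nth_map false) //; move: jw; rewrite size_set_nth; lia.
rewrite [RHS]nth_default ?size_map //; move: jw; rewrite size_set_nth => jw.
rewrite ifN; last by apply/eqP; lia.
by rewrite nth_default // size_map; lia.
Qed.

End Tapes.

Lemma set_nth_size (w : word) b : set_nth false w (size w) b = rcons w b.
Proof. by elim: w => //= a w ->. Qed.

(** * Guessing a tuple *)

Inductive guess_state (i : nat) : Type :=
  | GStart | GCopy | GAskCopy | GGuess of 'I_i.+2 | GCheck | GAskTuple | GRaise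
  | GAskCount | GAccept | GReject.
Arguments GStart {i}. Arguments GCopy {i}. Arguments GAskCopy {i}.
Arguments GCheck {i}. Arguments GAskTuple {i}. Arguments GRaise {i}.
Arguments GAskCount {i}. Arguments GAccept {i}. Arguments GReject {i}.

Definition guess_state_code i (q : guess_state i) : 'I_9 + 'I_i.+2 :=
  match q with
  | GStart => inl (inord 0) | GCopy => inl (inord 1) | GAskCopy => inl (inord 2)
  | GGuess c => inr c | GCheck => inl (inord 3) | GAskTuple => inl (inord 4)
  | GRaise => inl (inord 5) | GAskCount => inl (inord 6)
  | GAccept => inl (inord 7) | GReject => inl (inord 8)
  end.

Definition guess_state_decode i (u : 'I_9 + 'I_i.+2) : guess_state i :=
  match u with
  | inr c => GGuess c
  | inl j => nth GStart [:: GStart; GCopy; GAskCopy; GCheck; GAskTuple; GRaise;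
                            GAskCount; GAccept; GReject] j
  end.

Lemma guess_state_codeK i : cancel (@guess_state_code i) (@guess_state_decode i).
Proof. by case=> //=; rewrite inordK. Qed.

HB.instance Definition _ i := Countable.copy (guess_state i) (can_type (@guess_state_codeK i)).
HB.instance Definition _ i := Finite.copy (guess_state i) (can_type (@guess_state_codeK i)).

Section GuessMachine.
Variables (i : nat) (full : bool).

Let gcell : Type := option (bool + void).
Let gmoves : finType := {ffun bool -> option (bool + void) * option bool}.

Definition both (a b : gcell * option bool) : gmoves := [ffun t => if t then b else a].

Definition keep (s : {ffun bool -> gcell}) (d : option bool) : gmoves :=
  [ffun t => (s t, d)].

(** The counter follows the position in the guess and stays at [i.+1], the end of the forced prefix
    [1^i 0]; from there on [guess_allowed] permits both bits. *)
Definition next_count (c : nat) : nat := minn c.+1 i.+1.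

Definition guess_allowed (c : nat) (g : bool) : bool := (c <= i) ==> (g == (c < i)).

(** Tape [false] holds the input and tape [true] the question. [GCheck], entered with both heads on
    the last cell, demands an input ending in 1 and a guess ending in 0; inputs ending in 0 can
    therefore be accepted only by copying. *)
Definition guess_trans (q : guess_state i) (s : {ffun bool -> gcell})
    (a : guess_state i * gmoves) : bool :=
  match q with
  | GStart => (a == (GGuess ord0, keep s None)) || (full && (a == (GCopy, keep s None)))
  | GCopy =>
      if s false is Some (inl b) then
        a == (GCopy, both (s false, Some true) (Some (inl b), Some true))
      else a == (GAskCopy, keep s None)
  | GGuess c =>
      if s false is Some (inl _) then
        [exists g, guess_allowed c g && (a == (GGuess (inord (next_count c)),
           both (s false, Some true) (Some (inl g), Some true)))]
      else a == (GCheck, keep s (Some false))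
  | GCheck => [&& s false == Some (inl true), s true == Some (inl false)
                & a == (GAskTuple, keep s None)]
  | GRaise => a == (GAskCount, both (s false, None) (Some (inl true), None))
  | _ => false
  end.

(* On input [v] the machine guesses a word [u] of the same length, the code of an
   [i]-tuple if the oracle says so, and accepts if the oracle answers no to [u]
   with its last bit changed to 1, the question whether there are more than [i]
   elements.  If [full] is false, the second question is omitted; if [full] is
   true, the machine may instead put its own input to the oracle, so that a yes
   is passed on through the levels of a system. *)
Definition guess_machine : otm unit :=
  @OTM unit (guess_state i) void bool GStart (fun q => q == GAccept) false false
    (fun=> true)
    (fun q => match q with GAskCopy | GAskTuple | GAskCount => Some tt | _ => None end)
    (fun q b => match q with
       | GAskCopy => if b then GAccept else GReject
       | GAskTuple => if b then (if full then GRaise else GAccept) else GReject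
       | _ => if b then GReject else GAccept
       end)
    (fun q s => [set a | guess_trans q s a]%SET).

Let N := guess_machine.
Implicit Types (O : unit -> language) (c : config N) (p : seq (config N)).

Definition succ c (a : guess_state i * gmoves) : config N :=
  (a.1, [ffun t => @act unit N (a.2 t) (c.2 t)]).

Lemma step_transP O c c' : query c.1 = None ->
  reflect (exists2 a, guess_trans c.1 (scan c) a & c' = succ c a) (step O c c').
Proof.
rewrite /step => ->; apply: (iffP existsP) => [[a]|[a]].
  by rewrite inE => /andP[Ha /eqP ->]; exists a.
by move=> Ha ->; exists a; rewrite inE Ha eqxx.
Qed.

(** * Running time of the guessing machine *)

(** The gaps are wide enough for the one or two cells by which rewriting a blank and moving left
    enlarge the first summand of [fuel]. *)
Definition rank (q : guess_state i) : nat :=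
  match q with
  | GStart => 12 | GCopy => 10 | GGuess _ => 10 | GCheck => 6 | GAskTuple => 4
  | GRaise => 3 | GAskCount => 1 | GAskCopy => 1 | GAccept => 0 | GReject => 0
  end.

Definition fuel c : nat := size (c.2 false).1 - (c.2 false).2 + rank c.1.

Lemma nth_None_lt (T : Type) (s : seq (option T)) j x : nth None s j = Some x -> j < size s.
Proof. by move=> H; rewrite ltnNge; apply/negP => /(nth_default None); rewrite H. Qed.

Lemma fuel_decreases O c c' : step O c c' -> fuel c' < fuel c.
Proof.
case Eq: (query c.1) => [[]|].
  rewrite /step Eq => /eqP -> ; move: Eq; rewrite /fuel /= ltn_add2l.
  by case: (c.1) => // _; case: (_ \in _); case: (full).
case/(step_transP _ _ Eq) => a Ha ->; rewrite /fuel /succ /= ffunE /act /= size_set_nth.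
case: c Eq Ha => q tc /=; case: q => //= [_|_|k _|_|_]; rewrite ?ffunE /=.
- case/orP=> [|/andP[_]] /eqP -> /=; rewrite ffunE /=;
  move: (size _) (tc false).2 => n m; lia.
- case E: (nth _ _ _) => [[b|[]]|] /eqP -> /=; rewrite ffunE /=.
    have := nth_None_lt E; move: (size _) (tc false).2 => n m; lia.
  move: (size _) (tc false).2 => n m; lia.
- case E: (nth _ _ _) => [[b|[]]|].
    case/existsP=> g /andP[_ /eqP ->] /=; rewrite ffunE /=.
    have := nth_None_lt E; move: (size _) (tc false).2 => n m; lia.
  move/eqP=> -> /=; rewrite ffunE /=; move: (size _) (tc false).2 => n m; lia.
- case/and3P=> _ _ /eqP -> /=; rewrite ffunE /=.
  move: (size _) (tc false).2 => n m; lia.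
- move/eqP=> -> /=; rewrite ffunE /=; move: (size _) (tc false).2 => n m; lia.
Qed.

Lemma guess_machine_polytime : polytime_exp guess_machine 12.
Proof.
move=> O x p; rewrite /computation => Hp.
have H c : path (step O) c p -> size p <= fuel c.
  elim: p c {Hp} => //= c' p IHp c /andP[/fuel_decreases s /IHp]; lia.
apply: leq_trans (H _ Hp) _; rewrite /fuel /= ffunE /= size_map subn0 leq_add2r.
by case: (size x) => // n; rewrite -{1}(expn1 n.+1) leq_pexp2l.
Qed.

(** * The deterministic end of a path *)

Definition accepts_from O c p : Prop :=
  [/\ path (step O) c p, halted (last c p) & accepting (last c p).1].

Lemma accepts_from_cons O c c' p :
  step O c c' -> accepts_from O c (c' :: p) <-> accepts_from O c' p.
Proof. by move=> s; rewrite /accepts_from /= s; split=> -[]. Qed.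

(** In these states no choice is left, so an accepting path is determined by the choices made
    before. *)
Definition in_tail (q : guess_state i) : bool :=
  match q with GStart | GGuess _ => false | _ => true end.

Lemma in_tail_step O c c1 c2 :
  in_tail c.1 -> step O c c1 -> step O c c2 -> in_tail c1.1 /\ c1 = c2.
Proof.
case Eq: (query c.1) => [[]|] T.
  rewrite /step Eq => /eqP -> /eqP ->; split=> //=.
  by case: (c.1) Eq => //= _; case: (_ \in _); case: (full).
case/(step_transP _ _ Eq) => a Ha -> /(step_transP _ _ Eq) [b Hb ->].
case: c T Eq Ha Hb => q tc /=; case: q => //= _ _.
- by case: (@scan unit N _ false) => [[d|[]]|] /eqP -> /eqP ->.
- by case/and3P=> _ _ /eqP -> /and3P[_ _ /eqP ->].
- by move=> /eqP -> /eqP ->.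
Qed.

Lemma tail_unique O c p p' : in_tail c.1 ->
  accepts_from O c p -> accepts_from O c p' -> p = p'.
Proof.
elim: p c p' => [|c1 p IHp] c [|c2 p'] // T.
- by move=> [_ h _] [/andP[s _] _ _]; case/negP: (@halted_no_step _ _ O c c2 h).
- by move=> [/andP[s _] _ _] [_ h _]; case/negP: (@halted_no_step _ _ O c c1 h).
move=> A A'; have [/andP[s1 _] _ _] := A; have [/andP[s2 _] _ _] := A'.
have [T1 E] := in_tail_step T s1 s2; rewrite -E in A' s2 *.
by rewrite (IHp c1 p') //; [apply/(accepts_from_cons _ s1)|apply/(accepts_from_cons _ s2)].
Qed.

Lemma tail_step_accepts O c c' : in_tail c.1 -> step O c c' ->
  (exists p, accepts_from O c p) <-> (exists p, accepts_from O c' p).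
Proof.
move=> T s; split=> [[[|c1 p]]|[p Hp]].
- by case=> _ h _; case/negP: (@halted_no_step _ _ O c c' h).
- move=> A; have [/andP[s1 _] _ _] := A; have [_ E] := in_tail_step T s s1.
  by exists p; rewrite E; apply/(accepts_from_cons _ s1).
- by exists (c' :: p); apply/(accepts_from_cons _ s).
Qed.

Lemma no_transition_halted c : query c.1 = None ->
  (forall a, ~~ guess_trans c.1 (scan c) a) -> halted c.
Proof.
rewrite /halted => -> H /=; rewrite cards_eq0; apply/eqP/setP => a.
by rewrite !inE (negbTE (H a)).
Qed.

Lemma halted_accepts O c : halted c ->
  (exists p, accepts_from O c p) <-> c.1 = GAccept.
Proof.
move=> h; split=> [[[|c1 p]] []|E].
- by move=> _ _ /eqP.
- by case/andP=> s; case/negP: (@halted_no_step _ _ O c c1 h).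
- by exists [::]; split=> //=; rewrite E eqxx.
Qed.

Lemma accept_halted c : c.1 = GAccept -> halted c.
Proof. by move=> E; apply: no_transition_halted => [|a]; rewrite E. Qed.

Lemma reject_halted c : c.1 = GReject -> halted c.
Proof. by move=> E; apply: no_transition_halted => [|a]; rewrite E. Qed.

Lemma verdict_accepts O c (b : bool) :
  c.1 = (if b then GAccept else GReject) ->
  (exists p, accepts_from O c p) <-> b.
Proof.
case: b => E; first by rewrite (halted_accepts O (accept_halted E)) E.
by rewrite (halted_accepts O (reject_halted E)) E.
Qed.

Definition asked_word c : word := tape_word c true.

Lemma ask_step O c : query c.1 = Some tt ->
  step O c (answer c.1 (asked_word c \in O tt), c.2).
Proof. by rewrite /step => ->; exact: eqxx. Qed.

Lemma count_accepts O c : c.1 = GAskCount ->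
  (exists p, accepts_from O c p) <-> asked_word c \notin O tt.
Proof.
move=> E; rewrite (@tail_step_accepts O c _ _ (ask_step O _)) ?E //.
by apply: verdict_accepts; case: (_ \in _).
Qed.

Lemma copied_accepts O c : c.1 = GAskCopy ->
  (exists p, accepts_from O c p) <-> asked_word c \in O tt.
Proof.
move=> E; rewrite (@tail_step_accepts O c _ _ (ask_step O _)) ?E //.
by apply: verdict_accepts; case: (_ \in _).
Qed.

Definition raised (u : word) : word := set_nth false u (size u).-1 true.

(** The defaults of [last] are chosen so that empty words fail both tests, as the machine does on a
    blank cell. *)
Lemma check_accepts O c v u : c.1 = GCheck ->
    tape_is (c.2 false) v (size v).-1 -> tape_is (c.2 true) u (size u).-1 ->
    size u = size v ->
  (exists p, accepts_from O c p) <->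
  [/\ last false v, ~~ last true u, u \in O tt & full -> raised u \notin O tt].
Proof.
move=> E Tv Tu uv.
have sc0 : scan c false = (if 0 < size v then Some (inl (last false v)) else None).
  by rewrite ffunE (tape_is_scan Tv) nth_last; case: (v) => //= b w; rewrite ltnSn.
have sc1 : scan c true = (if 0 < size v then Some (inl (last true u)) else None).
  rewrite ffunE (tape_is_scan Tu) nth_last -uv.
  by case: (u) => //= b w; rewrite ltnSn.
have [ok|nok] := boolP [&& 0 < size v, last false v & ~~ last true u]; last first.
  rewrite (halted_accepts O); first rewrite E.
    split=> // -[l0 l1 _ _]; case/negP: nok; rewrite l0 l1.
    by case: (v) l0.
  apply: no_transition_halted => [|a]; first by rewrite E.
  rewrite E /= sc0 sc1; apply: contra nok; case: ltnP => //= _.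
  by case: (last false v); case: (last true u).
case/and3P: ok => v0 l0 l1.
have s0 : step O c (succ c (GAskTuple, keep (scan c) None)).
  apply/step_transP; first by rewrite E.
  exists (GAskTuple, keep (scan c) None) => //.
  by rewrite E /= sc0 sc1 v0 l0 (negbTE l1) !eqxx.
rewrite (tail_step_accepts _ s0) ?E //.
set c1 := succ _ _.
have Tu1 : tape_is (c1.2 true) u (size u).-1.
  by rewrite /= ffunE ffunE ffunE; exact: tape_is_keep None Tu.
have w1 : asked_word c1 = u by apply: tape_is_bits Tu1.
rewrite (@tail_step_accepts O c1 _ _ (ask_step O _)) // w1.
have [uO|uO] := boolP (u \in O tt); last first.
  by rewrite (@verdict_accepts _ _ false) //; split=> // -[].
case Ef: full; last first.
  by rewrite (@verdict_accepts _ _ true) //= Ef.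
set c2 := (_, c1.2).
have E2 : c2.1 = GRaise by rewrite /c2 /= Ef.
have s2 : step O c2 (succ c2 (GAskCount, both (scan c2 false, None) (Some (inl true), None))).
  apply/step_transP; first by rewrite E2.
  by exists (GAskCount, both (scan c2 false, None) (Some (inl true), None)); rewrite // E2 /=.
rewrite (tail_step_accepts _ s2) ?E2 // count_accepts //.
rewrite (_ : asked_word _ = raised u).
  by split=> [H|[_ _ _ H]]; [split|exact: H].
have T2 : tape_is ((succ c2 (GAskCount, both (scan c2 false, None)
    (Some (inl true), None))).2 true) (raised u) (size u).-1.
  rewrite /= ffunE ffunE /=; apply: (tape_is_write true None Tu1).
  by rewrite leq_pred.
exact: tape_is_bits T2.
Qed.

Lemma copy_accepts O c v j : c.1 = GCopy ->
    tape_is (c.2 false) v j -> tape_is (c.2 true) (take j v) j -> j <= size v ->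
  (exists p, accepts_from O c p) <-> v \in O tt.
Proof.
move Ed: (size v - j) => d; elim: d c j Ed => [|d IHd] c j Ed E Tv Tu jv.
  have Ej : j = size v by lia.
  have s0 : step O c (succ c (GAskCopy, keep (scan c) None)).
    apply/step_transP; first by rewrite E.
    exists (GAskCopy, keep (scan c) None) => //.
    by rewrite E /= ffunE (tape_is_scan Tv) Ej ltnn.
  rewrite (tail_step_accepts _ s0) ?E // copied_accepts //.
  rewrite (_ : asked_word _ = v) //.
  have T1 : tape_is ((succ c (GAskCopy, keep (scan c) None)).2 true) v j.
    rewrite /= ffunE ffunE ffunE.
    by rewrite -{1}(take_size v) -Ej; exact: tape_is_keep None Tu.
  exact: tape_is_bits T1.
have jv' : j < size v by lia.
set a : guess_state i * gmoves :=
  (GCopy, both (scan c false, Some true) (Some (inl (nth false v j)), Some true)).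
have s0 : step O c (succ c a).
  apply/step_transP; first by rewrite E.
  by exists a => //; rewrite E /= /a ffunE (tape_is_scan Tv) jv'.
rewrite (tail_step_accepts _ s0) ?E //; apply: (IHd _ j.+1) => //; first lia.
  by rewrite /= ffunE ffunE ffunE; exact: tape_is_keep (Some true) Tv.
rewrite /= ffunE ffunE /= (take_nth false jv').
rewrite -set_nth_size (size_takel jv).
by apply: (tape_is_write _ (Some true) Tu); rewrite size_takel.
Qed.

(** * The guessing phase *)

Definition guess_action c (g : bool) : guess_state i * gmoves :=
  (GGuess (inord (next_count (if c.1 is GGuess k then k else 0))),
   both (scan c false, Some true) (Some (inl g), Some true)).

Definition guess_succ c (g : bool) : config N := succ c (guess_action c g).

Definition guess_end c : config N := succ c (GCheck, keep (scan c) (Some false)).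

Definition guess_inv c (v u : word) : Prop :=
  [/\ exists2 k : 'I_i.+2, c.1 = GGuess k & k = minn (size u) i.+1 :> nat,
      tape_is (c.2 false) v (size u) & tape_is (c.2 true) u (size u)].

Definition guess_ok (u : word) : Prop :=
  forall j, j < size u -> j <= i -> nth false u j = (j < i).

Lemma guess_ok_rcons u g :
  guess_ok (rcons u g) <-> guess_ok u /\ guess_allowed (minn (size u) i.+1) g.
Proof.
rewrite /guess_allowed geq_min ltnn orbF; split=> [H|[H Hg] j].
  split=> [j ju ji|].
    by have := H j; rewrite size_rcons nth_rcons ju => ->; rewrite // ltnW.
  apply/implyP => ui; have := H (size u); rewrite size_rcons nth_rcons ltnn eqxx.
  by move=> -> //; rewrite (minn_idPl _) // leqW.
rewrite size_rcons nth_rcons ltnS leq_eqVlt => /predU1P[->|ju] ji; last by rewrite ju; apply: H.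
rewrite ltnn eqxx; move: Hg; rewrite ji /= => /eqP ->.
by rewrite (minn_idPl _) // leqW.
Qed.

Lemma guess_inv_succ c v u g : guess_inv c v u -> size u < size v ->
  guess_inv (guess_succ c g) v (rcons u g).
Proof.
case=> [[k E kE] Tv Tu] uv; split.
- exists (inord (next_count k)); first by rewrite /= E.
  by rewrite inordK /next_count ?size_rcons; have := ltn_ord k; lia.
- by rewrite /= !ffunE /= ?ffunE size_rcons; exact: tape_is_keep (Some true) Tv.
- rewrite /= !ffunE /= size_rcons -set_nth_size.
  exact: tape_is_write g (Some true) Tu (leqnn _).
Qed.

Lemma guess_step O c v u c' : guess_inv c v u -> size u < size v ->
  step O c c' <-> exists2 g, guess_allowed (minn (size u) i.+1) g & c' = guess_succ c g.
Proof.
case=> [[k E kE] Tv Tu] uv.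
have Q : query c.1 = None by rewrite E.
have sc : scan c false = Some (inl (nth false v (size u))).
  by rewrite ffunE (tape_is_scan Tv) uv.
split=> [/(step_transP _ _ Q)[a]|[g ag ->]].
  rewrite E /= sc => /existsP[g /andP[ag /eqP ->]] ->.
  exists g; first by rewrite -kE.
  by rewrite /guess_succ /guess_action E sc.
apply/(step_transP _ _ Q); exists (guess_action c g) => //.
rewrite E /= sc; apply/existsP; exists g; rewrite kE ag /=.
by rewrite /guess_action E sc -kE.
Qed.

Lemma guess_end_step O c v u c' : guess_inv c v u -> size u = size v ->
  step O c c' <-> c' = guess_end c.
Proof.
case=> [[k E kE] Tv Tu] uv.
have Q : query c.1 = None by rewrite E.
have sc : scan c false = None by rewrite ffunE (tape_is_scan Tv) uv ltnn.
split=> [/(step_transP _ _ Q)[a]|->]; first by rewrite E /= sc => /eqP ->.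
apply/(step_transP _ _ Q); exists (GCheck, keep (scan c) (Some false)) => //.
by rewrite E /= sc.
Qed.

Lemma guess_end_accepts O c v u : guess_inv c v u -> size u = size v ->
  (exists p, accepts_from O (guess_end c) p) <->
  [/\ last false v, ~~ last true u, u \in O tt & full -> raised u \notin O tt].
Proof.
case=> [_ Tv Tu] uv; apply: check_accepts => //.
  by rewrite -uv /= !ffunE; exact: tape_is_keep (Some false) Tv.
by rewrite /= !ffunE; exact: tape_is_keep (Some false) Tu.
Qed.

Definition guess_path c (u : word) p : seq (config N) :=
  scanl guess_succ c u ++ guess_end (foldl guess_succ c u) :: p.

(** Stated for a partial guess [u1], so that induction on the number of missing bits applies; the
    recovered word is what labels the path. *)
Lemma guess_runs O c v u1 p :
    guess_inv c v u1 -> size u1 <= size v -> guess_ok u1 -> accepts_from O c p ->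
  exists u2 p', [/\ size (u1 ++ u2) = size v, guess_ok (u1 ++ u2),
    p = guess_path c u2 p', accepts_from O (guess_end (foldl guess_succ c u2)) p' &
    guess_inv (foldl guess_succ c u2) v (u1 ++ u2)].
Proof.
move Ed: (size v - size u1) => d.
elim: d c u1 p Ed => [|d IHd] c u1 p Ed Hc uv ok A.
  have uv' : size u1 = size v by lia.
  exists [::]; rewrite cats0 /guess_path /=; case: p A => [|c1 p] A.
    have [_ _ /=] := A; have [[k -> _] _ _] := Hc; by [].
  have [/andP[s _] _ _] := A; have Ec1 := (guess_end_step O c1 Hc uv').1 s.
  exists p; rewrite -Ec1; split=> //.
  exact/(accepts_from_cons _ s).
have uv' : size u1 < size v by lia.
case: p A => [|c1 p] A; first by have [_ _ /=] := A; have [[k -> _] _ _] := Hc.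
have [/andP[s _] _ _] := A; have [g ag Ec1] := (guess_step O c1 Hc uv').1 s.
have A1 : accepts_from O c1 p by apply/(accepts_from_cons _ s).
have [||||u2 [p' [H1 H2 H3 H4 H5]]] := IHd c1 (rcons u1 g) p _ _ _ _ A1.
- by rewrite size_rcons; lia.
- by rewrite Ec1; exact: guess_inv_succ.
- by rewrite size_rcons.
- exact/guess_ok_rcons.
exists (g :: u2), p'; rewrite -cat_rcons; split=> //=; rewrite -?Ec1 //.
by rewrite H3 /guess_path /= -Ec1.
Qed.

Lemma guess_runs_exist O c v u1 u2 p' :
    guess_inv c v u1 -> size (u1 ++ u2) = size v -> guess_ok (u1 ++ u2) ->
    accepts_from O (guess_end (foldl guess_succ c u2)) p' ->
  accepts_from O c (guess_path c u2 p').
Proof.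
elim: u2 c u1 => [|g u2 IHu2] c u1 Hc uv ok A.
  rewrite cats0 in uv; apply/accepts_from_cons => //.
  exact/(guess_end_step O _ Hc uv).
have uv' : size u1 < size v by rewrite -uv size_cat /=; lia.
rewrite /guess_path /=; apply/accepts_from_cons; last first.
  apply: (IHu2 _ (rcons u1 g)); rewrite ?cat_rcons //; exact: guess_inv_succ.
apply/(guess_step O _ Hc uv'); exists g => //.
have : guess_ok (rcons u1 g).
  move=> j; rewrite size_rcons => ju ji.
  have := ok j; rewrite -cat_rcons size_cat size_rcons nth_cat size_rcons ju.
  by apply=> //; lia.
by case/guess_ok_rcons.
Qed.

(* An accepting path is determined by its label: the guessed word, or [None]
   when the input itself is passed on to the oracle. *)
Definition label_ok O (v : word) (l : option word) : Prop :=
  if l is Some u then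
    [/\ size u = size v, guess_ok u, last false v & ~~ last true u] /\
    (u \in O tt /\ (full -> raised u \notin O tt))
  else full /\ v \in O tt.

Definition start_succ v q : config N := succ (init N v) (q, keep (scan (init N v)) None).

Definition labelled v (l : option word) p p' : Prop :=
  if l is Some u then
    p = start_succ v (GGuess ord0) :: guess_path (start_succ v (GGuess ord0)) u p'
  else p = start_succ v GCopy :: p'.

Definition label_tail v (l : option word) : config N :=
  if l is Some u then guess_end (foldl guess_succ (start_succ v (GGuess ord0)) u)
  else start_succ v GCopy.

Lemma start_tapes v q : tape_is ((start_succ v q).2 false) v 0 /\
  tape_is ((start_succ v q).2 true) [::] 0.
Proof.
have H t w : tape_is ((init N v).2 t) w 0 -> tape_is ((start_succ v q).2 t) w 0.
  move=> /(tape_is_keep None); set tc := act _ _.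
  by rewrite (_ : (start_succ v q).2 t = tc) // /tc /= !ffunE.
by split; apply: H; rewrite /= ffunE.
Qed.

Lemma start_inv v : guess_inv (start_succ v (GGuess ord0)) v [::].
Proof. by have [H1 H2] := start_tapes v (GGuess ord0); split=> //; exists ord0. Qed.

Lemma start_step O v c : step O (init N v) c <->
  c = start_succ v (GGuess ord0) \/ full /\ c = start_succ v GCopy.
Proof.
have Q : query (init N v).1 = None by [].
split=> [/(step_transP _ _ Q)[a] /=|H].
  by case/orP=> [/eqP -> ->|/andP[f /eqP ->] ->]; [left|right].
apply/(step_transP _ _ Q); case: H => [->|[f ->]].
  by exists (GGuess ord0, keep (scan (init N v)) None) => //=; rewrite eqxx.
exists (GCopy, keep (scan (init N v)) None) => //.
  by apply/orP; right; rewrite f /= eqxx.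
Qed.

Lemma accepting_path_label O v p : accepting_path O v p ->
  exists l p', [/\ label_ok O v l, labelled v l p p' &
    accepts_from O (label_tail v l) p'].
Proof.
case/and3P=> Hp Hh Ha; have A : accepts_from O (init N v) p by split.
case: p A {Hp Hh Ha} => [|c p] A; first by case: A => _ _ /eqP.
have [/andP[s _] _ _] := A; have {A} A : accepts_from O c p by apply/(accepts_from_cons _ s).
case/start_step: s => [Ec|[f Ec]]; rewrite Ec in A *.
  have ok0 : guess_ok [::] by [].
  have [u [p' [H1 H2 H3 H4 H5]]] := guess_runs (start_inv v) (leq0n _) ok0 A.
  exists (Some u), p'; split=> //=; last by rewrite H3.
  have [l0 l1 uO fO] := (guess_end_accepts O H5 H1).1 (ex_intro _ _ H4).
  by split.
exists None, p; split=> //; split=> //.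
have [T1 T2] := start_tapes v GCopy.
have ca := @copy_accepts O (start_succ v GCopy) v 0 erefl T1.
by rewrite take0 in ca; exact: (ca T2 (leq0n _)).1 (ex_intro _ p A).
Qed.

Lemma label_accepting_path O v l : label_ok O v l -> exists p, accepting_path O v p.
Proof.
have lift p : accepts_from O (init N v) p -> exists p, accepting_path O v p.
  by case=> H1 H2 H3; exists p; apply/and3P; split.
case: l => [u|] /= H.
  case: H => [[uv ok l0 l1] [uO fO]].
  have inv : guess_inv (foldl guess_succ (start_succ v (GGuess ord0)) u) v u.
    have {ok l1 uO fO l0} : forall u2 c u1, guess_inv c v u1 -> size (u1 ++ u2) <= size v ->
        guess_inv (foldl guess_succ c u2) v (u1 ++ u2).
      elim=> [|g u2 IHu2] c u1 Hc; first by rewrite cats0.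
      rewrite -cat_rcons => Hu /=; apply: IHu2 => //; apply: guess_inv_succ => //.
      by move: Hu; rewrite size_cat size_rcons; lia.
    by move/(_ u _ _ (start_inv v)); apply; rewrite /= uv.
  have [p' Hp'] := (guess_end_accepts O inv uv).2 (And4 l0 l1 uO fO).
  have A := guess_runs_exist (start_inv v) uv ok Hp'.
  apply: lift; apply/accepts_from_cons; last exact: A.
  by apply/start_step; left.
case: H => f vO; have [T1 T2] := start_tapes v GCopy.
have ca := @copy_accepts O (start_succ v GCopy) v 0 erefl T1.
rewrite take0 in ca; have [p Hp] := (ca T2 (leq0n _)).2 vO.
apply: lift; apply/accepts_from_cons; last exact: Hp.
by apply/start_step; right.
Qed.

Lemma guess_machine_accepted O v :
  v \in accepted guess_machine O <-> exists l, label_ok O v l.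
Proof.
rewrite inE; split=> [[p /accepting_path_label[l [p' [H _ _]]]]|[l /label_accepting_path//]].
by exists l.
Qed.

(** Labels are injective on accepting paths: equal labels give the same guessing phase, and the rest
    is unique by [tail_unique]. Counting paths thus becomes counting witnesses. *)
Lemma guess_machine_paths O v m :
  at_most_many m (label_ok O v) -> at_most_accepting_paths guess_machine m O v.
Proof.
move=> few ps ups /allP aps.
have /choice[f Hf] (p : seq (config N)) : exists l, p \in ps ->
    exists p', [/\ label_ok O v l, labelled v l p p' &
      accepts_from O (label_tail v l) p'].
  have [/aps /accepting_path_label[l Hl]|_] := boolP (p \in ps); first by exists l.
  by exists None.
rewrite -(size_map f); apply: few => [|l /mapP[p /Hf[p' [H _ _]] ->] //].
rewrite map_inj_in_uniq // => p1 p2 /Hf[q1 [_ L1 A1]] /Hf[q2 [_ L2 A2]] E.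
rewrite -E in L2 A2; have Eq : q1 = q2.
  by apply: (tail_unique _ A1 A2); rewrite /label_tail; case: (f p1).
by move: L1 L2; rewrite Eq /labelled; case: (f p1) => [u|] -> ->.
Qed.

End GuessMachine.

(** * Nonempty blocks in [UP_le h] and in [USigma h] *)

Section Classes.
Variables (h : nat) (B : set elt).
Hypothesis pB : promise h B.

(** As a filtered pool it is sorted, hence itself the tuple of all elements of the block. *)
Definition block (m : nat) : seq word :=
  [seq z <- pool (chunk h m) | `[< B (m, z) >]].

Lemma mem_block m z : z \in block m <-> B (m, z).
Proof.
rewrite mem_filter mem_pool; split=> [/andP[/asboolP//]|Bz].
by have /and3P[_ _ ->] := pB.1 _ Bz; rewrite andbT; apply/asboolP.
Qed.

Lemma block_uniq m : uniq (block m).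
Proof. by rewrite filter_uniq // pool_uniq. Qed.

Lemma size_block m : size (block m) <= h.
Proof.
rewrite -(size_map (pair m)); apply: (pB.2 m).
  by rewrite map_inj_uniq ?block_uniq // => a b [].
by move=> _ /mapP[z /mem_block Bz ->].
Qed.

Lemma oracleP w :
  w \in oracle h B <-> exists2 s, tuple_ok h (size w) s &
    w = code_tuple (size w) s /\ {subset s <= block (size w)}.
Proof.
by rewrite inE; split=> -[s ok [E H]]; exists s => //; split=> // z /H /mem_block.
Qed.

Lemma oracle_last b w : w \in oracle h B -> last b w = false.
Proof. by case/oracleP=> s ok [-> _]; exact: last_code_tuple b ok. Qed.

Lemma guess_ok_code_tuple m s : guess_ok (size s) (code_tuple m s).
Proof.
move=> j _ js; rewrite /code_tuple nth_cat size_nseq nth_nseq.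
by case: ltngtP js => // -> _; rewrite subnn.
Qed.

Lemma guess_ok_size i m s : guess_ok i (code_tuple m s) -> size s = i.
Proof.
move=> H; have sz : size s < size (code_tuple m s).
  by rewrite /code_tuple size_cat size_nseq /=; lia.
case: (ltngtP (size s) i) => // si.
  have := H _ sz (ltnW si); rewrite si.
  by rewrite (guess_ok_code_tuple sz (leqnn _)) ltnn.
have := H _ (ltn_trans si sz) (leqnn _); rewrite ltnn.
by rewrite (guess_ok_code_tuple (ltn_trans si sz) (ltnW si)) si.
Qed.

(** A subsequence of the pool is determined by its set of members. This makes the full tuple the
    only witness when the number of components equals the size of the block. *)
Lemma tuple_subset_size m s : tuple_ok h m s -> {subset s <= block m} ->
  size s <= size (block m) /\ (size s = size (block m) -> s = block m).
Proof.
case/and3P=> _ _ sp sub; have us := subseq_uniq sp (pool_uniq _).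
split=> [|E]; first exact: uniq_leq_size.
have /subseq_uniqP Es := sp; rewrite (Es (pool_uniq _)); apply: eq_in_filter => z zp.
have [_ ->] := uniq_min_size us sub (eq_leq (esym E)).
by rewrite mem_filter zp andbT.
Qed.

Lemma block_tuple_ok m : 0 < size (block m) -> tuple_ok h m (block m).
Proof.
move=> b0; apply/and3P; split; last exact: filter_subseq.
  have : head [::] (block m) \in block m by case: (block m) b0 => //= z s _; exact: mem_head.
  by move/mem_block/pB.1 => /and3P[].
by rewrite b0 size_block.
Qed.

(** The oracle may be a lower level of the counting system, which adds to [oracle h B] only words
    ending in 1; the guess ends in 0, so the answer to it is that of [oracle h B]. *)
Lemma label_tuple i full Ls v u :
  label_ok i full (single_oracle Ls) v (Some u) ->
  (forall w, last true w = false -> w \in Ls -> w \in oracle h B) ->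
  exists2 s, tuple_ok h (size v) s & [/\ u = code_tuple (size v) s, size s = i,
    {subset s <= block (size v)} & last false v].
Proof.
case=> -[uv ok l0 /negbTE l1] [uL _] H.
have /oracleP[s sok [E sub]] := H u l1 uL.
rewrite uv in sok E sub; exists s => //; split=> //.
by apply: (@guess_ok_size i (size v)); rewrite -E.
Qed.

Lemma tuple_label i (full : bool) Ls v s :
    tuple_ok h (size v) s -> size s = i -> {subset s <= block (size v)} ->
    last false v ->
    (forall w, w \in oracle h B -> w \in Ls) ->
    (full -> raised (code_tuple (size v) s) \notin Ls) ->
  label_ok i full (single_oracle Ls) v (Some (code_tuple (size v) s)).
Proof.
move=> ok si sub lv HL Hr; have sz := size_code_tuple ok.
split; split=> //.
- by rewrite -si; exact: guess_ok_code_tuple.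
- by rewrite (last_code_tuple true ok).
- by apply: HL; apply/oracleP; rewrite sz; exists s.
Qed.

Definition nonempty_block : language :=
  accepted (guess_machine 1 false) (single_oracle (oracle h B)).

Lemma nonempty_block_UP : UP_le h (oracle h B) nonempty_block.
Proof.
exists (guess_machine 1 false); split=> //; first by exists 12; exact: guess_machine_polytime.
move=> v; apply: guess_machine_paths => ls uls Hls.
apply: leq_trans (size_block (size v)).
rewrite -(size_map (fun z => Some (code_tuple (size v) [:: z]))).
apply: uniq_leq_size => // l /Hls; case: l => [u|[] //].
move=> H; have [s ok [-> si sub _]] := label_tuple H (fun w _ => id).
case: s si sub {ok} => [|z [|]] // _ sub.
by apply: map_f; apply: sub; exact: mem_head.
Qed.

Lemma nonempty_blockP m : 0 < h -> 0 < m ->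
  nseq m true \in nonempty_block <-> 0 < size (block m).
Proof.
move=> h0 m0; rewrite /nonempty_block guess_machine_accepted.
split=> [[[u|[]//]]|].
  move=> H; have [s ok [_ si sub _]] := label_tuple H (fun w _ => id).
  by rewrite size_nseq in ok sub; have [+ _] := tuple_subset_size ok sub; rewrite si.
case Eb: (block m) => [//|z s] _.
have zb : z \in block m by rewrite Eb mem_head.
have ok : tuple_ok h m (block m) by apply: block_tuple_ok; rewrite Eb.
exists (Some (code_tuple (size (nseq m true)) [:: z])).
apply: tuple_label => //.
- rewrite size_nseq; case/and3P: ok => c0 _ _; rewrite /tuple_ok c0 h0 /=.
  by rewrite sub1seq; move: zb; rewrite mem_filter => /andP[].
- by rewrite size_nseq => _ /[!inE] /eqP ->.
- by case: m m0 {Eb zb ok} => // m _; rewrite -[nseq _ _]cat0s; elim: m.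
Qed.

(* On words ending in 1, the top machine decides whether the block has at least
   [h - d + 1] elements; other words are passed down to the oracle. *)
Fixpoint counting_system (d : nat) : seq (otm unit) :=
  if d is d'.+1 then guess_machine (h - d') true :: counting_system d' else [::].

Lemma last_raised b u : 0 < size u -> last b (raised u) = true.
Proof.
move=> u0; rewrite -nth_last /raised size_set_nth (maxn_idPr _) ?prednK //.
by rewrite (set_nth_default false) ?nth_set_nth /= ?eqxx // size_set_nth; lia.
Qed.

Lemma counting_systemP d : d <= h ->
  unambiguous (oracle h B) (counting_system d) /\
  forall w, w \in system_language (oracle h B) (counting_system d) <->
    w \in oracle h B \/ (last false w /\ h - d < size (block (size w))).
Proof.
elim: d => [_|d IHd dh]; first split=> // w.
  by rewrite subn0; split=> [|[//|[_]]]; [left|have := size_block (size w); lia].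
have [unamb sem] := IHd (ltnW dh).
set Ls := system_language _ _ in sem.
have inL w : w \in oracle h B -> w \in Ls by move=> wB; apply/sem; left.
have onL w : last true w = false -> w \in Ls -> w \in oracle h B.
  move=> lw /sem[//|[]]; case: w lw => //= b w; by case: (last b w).
(* A guessed tuple gives at least [h - d] elements, and the denied counting question, which ends in
   1 and has the same length, gives at most as many. *)
have labelE v u : label_ok (h - d) true (single_oracle Ls) v (Some u) ->
    [/\ u = code_tuple (size v) (block (size v)),
        size (block (size v)) = h - d & last false v].
  move=> H; have [s ok [Eu si sub lv]] := label_tuple H onL.
  have [le eq] := tuple_subset_size ok sub.
  have [uv rL] : size u = size v /\ raised u \notin Ls.
    by case: H => -[uv _ _ _] [_ /(_ isT)].
  have v0 : 0 < size v by case: (v) lv.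
  have sb : size (block (size v)) = h - d.
    apply/eqP; rewrite eqn_leq -{2}si le andbT leqNgt; apply: contra rL => lt.
    apply/sem; right; rewrite last_raised ?uv //; split=> //.
    rewrite /raised size_set_nth uv (maxn_idPr _) // prednK //.
  by rewrite Eu -eq // si sb.
have sem' w : w \in system_language (oracle h B) (counting_system d.+1) <->
    w \in oracle h B \/ (last false w /\ h - d.+1 < size (block (size w))).
  rewrite /= -/Ls guess_machine_accepted; split=> [[[u /labelE[_ sb lw]|[_ /sem]]]|].
  - by right; split=> //; lia.
  - by case=> [|[lw lt]]; [left|right; split=> //; lia].
  case=> [wB|[lw lt]]; first by exists None; split=> //; apply: inL.
  have [lt'|ge] := ltnP (h - d) (size (block (size w))).
    by exists None; split=> //; apply/sem; right.
  have sb : size (block (size w)) = h - d by lia.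
  have ok := block_tuple_ok (leq_trans (ltn0Sn _) lt).
  exists (Some (code_tuple (size w) (block (size w)))).
  apply: tuple_label => // _; apply/negP => /sem.
  have sz := size_code_tuple ok; have w0 : 0 < size w by case: (w) lw.
  case=> [/(oracle_last false)|[_]]; first by rewrite last_raised ?sz.
  by rewrite /raised size_set_nth sz (maxn_idPr _) ?prednK // sb ltnn.
split=> //; split=> //= v; apply: guess_machine_paths; rewrite -/Ls.
have label_uniq l1 l2 : label_ok (h - d) true (single_oracle Ls) v l1 ->
    label_ok (h - d) true (single_oracle Ls) v l2 -> l1 = l2.
  (* A successful guess fixes the size of the block at [h - d], whereas a yes passed on says that it
     is larger; a yes of [oracle h B] itself would need an input ending in 0. *)
  have absurd u : label_ok (h - d) true (single_oracle Ls) v (Some u) ->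
      v \in Ls -> False.
    case/labelE=> _ sb lv /sem[/(oracle_last false)|[_]]; first by rewrite lv.
    by rewrite sb ltnn.
  case: l1 l2 => [u1|] [u2|] // H1 H2.
  - by have [-> _ _] := labelE _ _ H1; have [-> _ _] := labelE _ _ H2.
  - by case: (absurd _ H1); case: H2.
  - by case: (absurd _ H2); case: H1.
case=> [|l1 [|l2 ls]] // /and3P[+ _ _] H.
by rewrite inE (label_uniq l1 l2) ?eqxx //; apply: H; rewrite !inE eqxx ?orbT.
Qed.

Definition counted_block : language :=
  system_language (oracle h B) (counting_system h).

Lemma counted_block_USigma : USigma h (oracle h B) counted_block.
Proof.
have [unamb _] := counting_systemP (leqnn h).
exists (counting_system h); split=> //.
  by elim: {unamb} h => //= d ->.
elim: (X in counting_system X) => //= d IHd; split=> //.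
by exists 12; exact: guess_machine_polytime.
Qed.

Lemma counted_blockP m : 0 < m ->
  nseq m true \in counted_block <-> 0 < size (block m).
Proof.
move=> m0; have [_ ->] := counting_systemP (leqnn h).
have lm : last false (nseq m true) by case: m m0 => // m _ /=; elim: m.
rewrite size_nseq subnn lm; split=> [[/(oracle_last false)|[]//]|]; last by right.
by rewrite lm.
Qed.

End Classes.

(** * Listing the lengths of the blocks *)

Section BitsOf.
Context {I : finType} {M : otm I}.
Implicit Types s : seq (cell M).

Lemma bits_of_scan s j :
  nth None s j = Some (inl (nth false (bits_of s) j)) \/ size (bits_of s) <= j.
Proof.
elim: s j => [|[[b|a]|] s IHs] [|j] /=; try by right.
- by left.
- by case: (IHs j) => [->|]; [left|right].
Qed.

Lemma bits_of_end s b : nth None s (size (bits_of s)) <> Some (inl b).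
Proof. by elim: s => [|[[c|a]|] s IHs]. Qed.

Lemma bits_of_write s j b : j < size (bits_of s) ->
  bits_of (set_nth None s j (Some (inl b))) = set_nth false (bits_of s) j b.
Proof.
elim: s j => [|[[c|a]|] s IHs] [|j] //= js.
by rewrite IHs.
Qed.

End BitsOf.

Inductive list_state : Type := LMark | LUnary | LRewind | LSeek | LEmit | LEmit2 | LBack | LDecr.

Definition list_state_code (q : list_state) : 'I_8 :=
  inord match q with
  | LMark => 0 | LUnary => 1 | LRewind => 2 | LSeek => 3 | LEmit => 4
  | LEmit2 => 5 | LBack => 6 | LDecr => 7
  end.

Definition list_state_decode (j : 'I_8) : list_state :=
  nth LMark [:: LMark; LUnary; LRewind; LSeek; LEmit; LEmit2; LBack; LDecr] j.

Lemma list_state_codeK : cancel list_state_code list_state_decode.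
Proof. by case; rewrite /list_state_decode inordK. Qed.

HB.instance Definition _ := Countable.copy list_state (can_type list_state_codeK).
HB.instance Definition _ := Finite.copy list_state (can_type list_state_codeK).

Section ListMachine.
Variable (M : otm void).

Let ltape : finType := (tape M + option bool)%type.
Let lcell : Type := cell M.
Let lstate : finType := (state M + list_state)%type.
Let lmoves : finType := {ffun ltape -> option (bool + symbol M) * option bool}.
Let inn := in_tape M.
Let out := out_tape M.

(* [unary] holds [0 1^m]; [mark] has a 0 in its leftmost cell and its head moves
   with the head of the output tape of [M]. *)
Definition unary : ltape := inr None.
Definition mark : ltape := inr (Some false).
Definition output : ltape := inr (Some true).

Definition moves (a : tape M -> lcell * option bool) (u : lcell * option bool)
    (c : lcell) (o : lcell * option bool) : lmoves :=
  [ffun t : ltape => match t with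
     | inl t => a t
     | inr None => u
     | inr (Some false) => (c, (a out).2)
     | inr (Some true) => o
     end].

Definition stay (s : {ffun ltape -> lcell}) (t : ltape) : lcell * option bool :=
  (s t, None).

Definition stay_but (s : {ffun ltape -> lcell}) (t0 : tape M) v (t : tape M) :
    lcell * option bool :=
  if t == t0 then v else stay s (inl t).

(* The machine replaces its input by [1^n], runs [M] on it, and uses the word on
   the output tape of [M] as a counter: it writes the code of [1^m], increments
   [m] and decrements the counter, until the counter underflows. *)
Definition list_next (q : lstate) (s : {ffun ltape -> lcell}) :
    option (lstate * lmoves) :=
  let zero := Some (inl false) in let one := Some (inl true) in
  let idle := fun t => stay s (inl t) in
  match q with
  | inr LMark =>
      Some (inr LUnary, moves idle (zero, Some true) zero (stay s output))
  | inr LUnary =>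
      if s (inl inn) is Some (inl _) then
        Some (inr LUnary, moves (stay_but s inn (one, Some true))
          (one, Some true) (s mark) (stay s output))
      else Some (inr LRewind, moves idle (stay s unary) (s mark) (stay s output))
  | inr LRewind =>
      if s unary == zero then
        Some (inl (start M), moves idle (stay s unary) (s mark) (stay s output))
      else Some (inr LRewind, moves (stay_but s inn (s (inl inn), Some false))
          (s unary, Some false) (s mark) (stay s output))
  | inl q =>
      if [pick a in delta q [ffun t => s (inl t)]] is Some a then
        Some (inl a.1, moves a.2 (stay s unary) (s mark) (stay s output))
      else Some (inr LSeek, moves idle (stay s unary) (s mark) (stay s output))
  | inr LSeek =>
      if s mark == zero then
        Some (inr LEmit, moves idle (s unary, Some true) (s mark) (stay s output))
      else Some (inr LSeek, moves (stay_but s out (s (inl out), Some false))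
          (stay s unary) (s mark) (stay s output))
  | inr LEmit =>
      if s unary == one then
        Some (inr LEmit2, moves idle (stay s unary) (s mark) (one, Some true))
      else Some (inr LBack, moves idle (one, None) (s mark) (zero, Some true))
  | inr LEmit2 =>
      Some (inr LEmit, moves idle (s unary, Some true) (s mark) (one, Some true))
  | inr LBack =>
      if s unary == zero then
        Some (inr LDecr, moves idle (stay s unary) (s mark) (stay s output))
      else Some (inr LBack, moves idle (s unary, Some false) (s mark) (stay s output))
  | inr LDecr =>
      match s (inl out) with
      | Some (inl false) => Some (inr LDecr, moves (stay_but s out (one, Some true))
          (stay s unary) (s mark) (stay s output))
      | Some (inl true) => Some (inr LSeek, moves (stay_but s out (zero, None))
          (stay s unary) (s mark) (stay s output))
      | _ => None
      end
  end.

Definition list_machine : otm void :=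
  @OTM void lstate (symbol M) ltape (inr LMark) pred0 (inl inn) output
    (of_void _) (fun=> None) (fun q _ => q)
    (fun q s => if list_next q s is Some a then [set a]%SET else finset.set0).

Let N := list_machine.
Implicit Types (c : config N).

Lemma list_machine_deterministic : deterministic list_machine.
Proof. by move=> q s /=; case: (list_next q s) => [a|]; rewrite ?cards1 ?cards0. Qed.

Definition list_succ c (a : lstate * lmoves) : config N :=
  (a.1, [ffun t => @act void N (a.2 t) (c.2 t)]).

Definition list_step c : option (config N) :=
  omap (list_succ c) (list_next c.1 (scan c)).

Lemma list_stepE O c c' : step O c c' = (list_step c == Some c').
Proof.
rewrite /step /list_step /=; apply/existsP/eqP => [[a /andP[]]|].
  by case: list_next => [b|]; rewrite inE // => /eqP -> /eqP ->.
case E: list_next => [b|] //= [<-]; exists b.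
by rewrite inE !eqxx.
Qed.

Lemma list_halted c : halted c = (list_step c == None).
Proof.
by rewrite /halted /list_step /=; case: list_next => [b|] /=; rewrite ?cards1 ?cards0.
Qed.

Fixpoint runs (n : nat) c c' : Prop :=
  if n is n'.+1 then exists2 c1, list_step c = Some c1 & runs n' c1 c' else c = c'.

Definition reaches (n : nat) c c' : Prop := exists2 m, m <= n & runs m c c'.

Lemma reaches_refl c n : reaches n c c.
Proof. by exists 0. Qed.

Lemma reaches_step n c c1 c' :
  list_step c = Some c1 -> reaches n c1 c' -> reaches n.+1 c c'.
Proof. by move=> s [m mn r]; exists m.+1 => //; exists c1. Qed.

Lemma reaches_trans n m c c1 c' :
  reaches n c c1 -> reaches m c1 c' -> reaches (n + m) c c'.
Proof.
move=> [a an ra] [b bm rb]; exists (a + b); first exact: leq_add.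
elim: a {an} c ra => [|a IHa] c /=; first by move=> ->.
by case=> c2 s /IHa; exists c2.
Qed.

Lemma reaches_le n m c c' : n <= m -> reaches n c c' -> reaches m c c'.
Proof. by move=> nm [a an r]; exists a => //; apply: leq_trans nm. Qed.

Lemma runs_path O n c c' : runs n c c' ->
  exists p, [/\ size p = n, path (step O) c p & last c p = c'].
Proof.
elim: n c => [|n IHn] c /=; first by move=> ->; exists [::].
case=> c1 s /IHn[p [sp Hp lp]]; exists (c1 :: p); split=> //=; first by rewrite sp.
by rewrite list_stepE s eqxx.
Qed.

(** * The loop that emits a word and decrements the counter *)

(** The counter tape is described by [bits_of] only, since [M] may have left anything behind its
    output word; the other tapes are known completely. *)
Definition counter_inv c (w : word) (j m u : nat) (o : word) : Prop :=
  [/\ bits_of (c.2 (inl out)).1 = w, (c.2 (inl out)).2 = j,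
      tape_is (c.2 mark) [:: false] j,
      tape_is (c.2 unary) (false :: nseq m true) u &
      tape_is (c.2 output) o (size o)].

Lemma bits_of_keep (s : seq (cell N)) j :
  bits_of (set_nth None s j (nth None s j)) = bits_of s.
Proof. by apply: bits_of_nth => l; exact: set_nth_same. Qed.

Lemma append_tape c t b w : tape_is (c.2 t) w (size w) ->
  tape_is (@act void N (Some (inl b), Some true) (c.2 t)) (rcons w b) (size (rcons w b)).
Proof.
move=> T; rewrite size_rcons -set_nth_size.
exact: tape_is_write b (Some true) T (leqnn _).
Qed.

(** A head does not notice the left end of its tape; the 0 on [mark], whose head moves along,
    signals it. *)
Lemma seek_phase c w j m o : c.1 = inr LSeek -> counter_inv c w j m 0 o ->
  exists c', [/\ reaches j.+1 c c', c'.1 = inr LEmit & counter_inv c' w 0 m 1 o].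
Proof.
elim: j c => [|j IHj] c E [Hw Hj Tc Tu To].
  exists (list_succ c (inr LEmit, moves (fun t => stay (scan c) (inl t))
    (scan c unary, Some true) (scan c mark) (stay (scan c) output))); split=> //.
    apply: reaches_step (reaches_refl _ _).
    rewrite /list_step E /= (_ : scan c mark = Some (inl false)) //.
    by rewrite ffunE (tape_is_scan Tc).
  split; rewrite /= !ffunE /stay /= ?ffunE.
  - by rewrite bits_of_keep.
  - by [].
  - exact: tape_is_keep None Tc.
  - exact: tape_is_keep (Some true) Tu.
  - exact: tape_is_keep None To.
set c1 := list_succ c (inr LSeek, moves (stay_but (scan c) out (scan c (inl out), Some false))
   (stay (scan c) unary) (scan c mark) (stay (scan c) output)).
have s1 : list_step c = Some c1.
  rewrite /list_step /c1 E /= (_ : scan c mark = None) //.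
  by rewrite ffunE (tape_is_scan Tc).
have [|c' [r E' I']] := IHj c1 erefl; last first.
  by exists c'; split=> //; apply: reaches_step s1 r.
split; rewrite /= !ffunE /stay_but /stay ?eqxx /= ?ffunE.
- by rewrite bits_of_keep.
- by rewrite Hj.
- exact: tape_is_keep (Some false) Tc.
- exact: tape_is_keep None Tu.
- exact: tape_is_keep None To.
Qed.

Lemma set_nth_nseq (b : bool) m : set_nth false (nseq m b) m b = nseq m.+1 b.
Proof. by elim: m => //= m ->. Qed.

(** Each remaining 1 is emitted as [11] and the word is closed by 0. The first blank on [unary] is
    overwritten by 1, which performs the increment of [m]. *)
Lemma emit_phase c w j m u o : u <= m -> c.1 = inr LEmit ->
    counter_inv c w j m u.+1 o ->
  exists c', [/\ reaches (2 * (m - u)).+1 c c', c'.1 = inr LBack &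
    counter_inv c' w j m.+1 m.+1 (o ++ rcons (nseq (2 * (m - u)) true) false)].
Proof.
move Ed: (m - u) => d; elim: d c u o Ed => [|d IHd] c u o Ed um E [Hw Hj Tc Tu To].
  have Eu : u = m by lia.
  set c1 := list_succ c (inr LBack, moves (fun t => stay (scan c) (inl t))
    (Some (inl true), None) (scan c mark) (Some (inl false), Some true)).
  have s1 : list_step c = Some c1.
    rewrite /list_step /c1 E /= (_ : scan c unary = None) //.
    by rewrite ffunE (tape_is_scan Tu) /= size_nseq Eu ltnn.
  exists c1; split=> //; first exact: reaches_step s1 (reaches_refl _ _).
  split; rewrite /= !ffunE /stay /= ?ffunE.
  - by rewrite bits_of_keep.
  - by [].
  - exact: tape_is_keep None Tc.
  - have := tape_is_write true None Tu; rewrite /= size_nseq Eu ltnSn => /(_ isT).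
    by rewrite set_nth_nseq.
  - by rewrite cats1; have H := append_tape false To; exact H.
set c1 := list_succ c (inr LEmit2, moves (fun t => stay (scan c) (inl t))
  (stay (scan c) unary) (scan c mark) (Some (inl true), Some true)).
have s1 : list_step c = Some c1.
  rewrite /list_step /c1 E /= (_ : scan c unary = Some (inl true)) //.
  have um' : u < m by clear -Ed; lia.
  by rewrite ffunE (tape_is_scan Tu) /= size_nseq nth_nseq ltnS um'.
set c2 := list_succ c1 (inr LEmit, moves (fun t => stay (scan c1) (inl t))
  (scan c1 unary, Some true) (scan c1 mark) (Some (inl true), Some true)).
have s2 : list_step c1 = Some c2 by [].
have I1 : [/\ bits_of (c1.2 (inl out)).1 = w, (c1.2 (inl out)).2 = j,
      tape_is (c1.2 mark) [:: false] j,
      tape_is (c1.2 unary) (false :: nseq m true) u.+1 &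
      tape_is (c1.2 output) (rcons o true) (size (rcons o true))].
  split; rewrite /= !ffunE /stay /= ?ffunE.
  - by rewrite bits_of_keep.
  - by [].
  - exact: tape_is_keep None Tc.
  - exact: tape_is_keep None Tu.
  - by have H := append_tape true To; exact H.
have I2 : counter_inv c2 w j m u.+2 (rcons (rcons o true) true).
  have [Hw1 Hj1 Tc1 Tu1 To1] := I1; rewrite /c2; move: c1 Hw1 Hj1 Tc1 Tu1 To1 {s1 c2 s2 I1}.
  move=> c1 Hw1 Hj1 Tc1 Tu1 To1.
  split; rewrite /= !ffunE /stay /= ?ffunE.
  - by rewrite bits_of_keep.
  - by [].
  - exact: tape_is_keep None Tc1.
  - exact: tape_is_keep (Some true) Tu1.
  - by have H := append_tape true To1; exact H.
have [||c' [r E' I']] := IHd c2 u.+1 _ _ _ erefl I2; [lia|lia|].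
exists c'; split=> //.
  rewrite (_ : (2 * d.+1).+1 = (2 * d).+3); last lia.
  by apply: reaches_step s1 _; apply: reaches_step s2 _.
by move: I'; rewrite (_ : 2 * d.+1 = (2 * d).+2) /= ?cat_rcons //; lia.
Qed.

Lemma back_phase c w j m u o : u <= m -> c.1 = inr LBack -> counter_inv c w j m u o ->
  exists c', [/\ reaches u.+1 c c', c'.1 = inr LDecr & counter_inv c' w j m 0 o].
Proof.
elim: u c => [|u IHu] c um E [Hw Hj Tc Tu To].
  set c1 := list_succ c (inr LDecr, moves (fun t => stay (scan c) (inl t))
    (stay (scan c) unary) (scan c mark) (stay (scan c) output)).
  have s1 : list_step c = Some c1.
    rewrite /list_step /c1 E /= (_ : scan c unary = Some (inl false)) //.
    by rewrite ffunE (tape_is_scan Tu).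
  exists c1; split=> //; first exact: reaches_step s1 (reaches_refl _ _).
  split; rewrite /= !ffunE /stay /= ?ffunE.
  - by rewrite bits_of_keep.
  - by [].
  - exact: tape_is_keep None Tc.
  - exact: tape_is_keep None Tu.
  - exact: tape_is_keep None To.
set c1 := list_succ c (inr LBack, moves (fun t => stay (scan c) (inl t))
   (scan c unary, Some false) (scan c mark) (stay (scan c) output)).
have s1 : list_step c = Some c1.
  rewrite /list_step /c1 E /= (_ : scan c unary = Some (inl true)) //.
  by rewrite ffunE (tape_is_scan Tu) /= size_nseq nth_nseq ltnS um.
have [||c' [r E' I']] := IHu c1 _ erefl; [lia| |]; last first.
  by exists c'; split=> //; apply: reaches_step s1 r.
split; rewrite /= !ffunE /stay /= ?ffunE.
- by rewrite bits_of_keep.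
- by [].
- exact: tape_is_keep None Tc.
- exact: tape_is_keep (Some false) Tu.
- exact: tape_is_keep None To.
Qed.

Lemma nseq_rcons (b : bool) j : rcons (nseq j b) b = nseq j.+1 b.
Proof. by elim: j => //= j ->. Qed.

Lemma nth_nseq_cat (b : bool) j w : nth false (nseq j b ++ w) j = head false w.
Proof. by rewrite nth_cat size_nseq ltnn subnn nth0. Qed.

Lemma set_nth_nseq_cat (b b' b'' : bool) j w :
  set_nth false (nseq j b ++ b' :: w) j b'' = nseq j b ++ b'' :: w.
Proof. by elim: j => //= j ->. Qed.

Lemma borrow_step c j m w o :
    c.1 = inr LDecr -> counter_inv c (nseq j true ++ false :: w) j m 0 o ->
  exists c', [/\ list_step c = Some c', c'.1 = inr LDecr &
    counter_inv c' (nseq j.+1 true ++ w) j.+1 m 0 o].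
Proof.
move=> E [Hw Hj Tc Tu To].
have ls : j < size (bits_of (c.2 (inl out)).1) by rewrite Hw size_cat size_nseq /=; lia.
have sc : scan c (inl out) = Some (inl false).
  rewrite ffunE Hj; case: (bits_of_scan (c.2 (inl out)).1 j) => [->|]; last by lia.
  by rewrite Hw nth_nseq_cat.
exists (list_succ c (inr LDecr, moves (stay_but (scan c) out (Some (inl true), Some true))
  (stay (scan c) unary) (scan c mark) (stay (scan c) output))); split=> //.
  by rewrite /list_step E /= sc.
split; rewrite /= !ffunE /stay_but /stay ?eqxx /= ?ffunE.
- by rewrite Hj bits_of_write // Hw set_nth_nseq_cat -cat_rcons nseq_rcons.
- by rewrite Hj.
- exact: tape_is_keep (Some true) Tc.
- exact: tape_is_keep None Tu.
- exact: tape_is_keep None To.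
Qed.

Lemma decrement_phase c a w j m o :
    c.1 = inr LDecr -> counter_inv c (nseq j true ++ nseq a false ++ true :: w) j m 0 o ->
  exists c', [/\ reaches a.+1 c c', c'.1 = inr LSeek &
    counter_inv c' (nseq (j + a) true ++ false :: w) (j + a) m 0 o].
Proof.
elim: a c j => [|a IHa] c j E I; last first.
  have [c1 [s1 E1 I1]] := borrow_step E I.
  have [c' [r E' I']] := IHa c1 j.+1 E1 I1; rewrite addSnnS in I'.
  by exists c'; split=> //; apply: reaches_step s1 r.
have [Hw Hj Tc Tu To] := I.
have ls : j < size (bits_of (c.2 (inl out)).1) by rewrite Hw size_cat size_nseq /=; lia.
have sc : scan c (inl out) = Some (inl true).
  rewrite ffunE Hj; case: (bits_of_scan (c.2 (inl out)).1 j) => [->|]; last by lia.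
  by rewrite Hw nth_nseq_cat.
set c1 := list_succ c (inr LSeek, moves (stay_but (scan c) out (Some (inl false), None))
  (stay (scan c) unary) (scan c mark) (stay (scan c) output)).
have s1 : list_step c = Some c1 by rewrite /list_step /c1 E /= sc.
exists c1; split=> //; first exact: reaches_step s1 (reaches_refl _ _).
rewrite addn0; split; rewrite /= !ffunE /stay_but /stay ?eqxx /= ?ffunE.
- by rewrite Hj bits_of_write // Hw set_nth_nseq_cat.
- by rewrite Hj.
- exact: tape_is_keep None Tc.
- exact: tape_is_keep None Tu.
- exact: tape_is_keep None To.
Qed.

(** Decrementing zero turns all bits into 1 and runs into a cell without a bit, where the machine
    halts. *)
Lemma underflow_phase c a j m o :
    c.1 = inr LDecr -> counter_inv c (nseq j true ++ nseq a false) j m 0 o ->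
  exists c', [/\ reaches a c c', list_step c' = None &
    tape_is (c'.2 output) o (size o)].
Proof.
elim: a c j => [|a IHa] c j E I; last first.
  have [c1 [s1 E1 I1]] := borrow_step E I.
  have [c' [r E' I']] := IHa c1 j.+1 E1 I1.
  by exists c'; split=> //; apply: reaches_step s1 r.
have [Hw Hj Tc Tu To] := I; exists c; split=> //; first exact: reaches_refl.
rewrite /list_step E /=; case Es: (scan c (inl out)) => [[b|]|] //.
case: (@bits_of_end _ N (c.2 (inl out)).1 b); rewrite -Es ffunE Hj Hw.
by rewrite cats0 size_nseq.
Qed.

Lemma binary_value_cons b w : binary_value (b :: w) = b + (binary_value w).*2.
Proof. by []. Qed.

Lemma binary_value0 w : binary_value w = 0 -> w = nseq (size w) false.
Proof.
elim: w => // b w IHw; rewrite binary_value_cons => H.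
have [-> /IHw Hw] : b = false /\ binary_value w = 0 by case: b H => /=; lia.
by rewrite [in LHS]Hw.
Qed.

(** Borrowing, least significant bit first: [0^a 1] becomes [1^a 0]. *)
Lemma binary_valueS w v : binary_value w = v.+1 ->
  exists a w', w = nseq a false ++ true :: w' /\
    binary_value (nseq a true ++ false :: w') = v.
Proof.
elim: w v => // -[] w IHw v; rewrite binary_value_cons => H.
  by exists 0, w; split=> //; rewrite cat0s binary_value_cons; lia.
have [u Hu] : exists u, binary_value w = u.+1 by exists (binary_value w).-1; lia.
have [a [w' [Ew Hw']]] := IHw u Hu; exists a.+1, w'; split; first by rewrite Ew.
rewrite -[nseq _ _ ++ _]/(true :: (nseq a true ++ false :: w')).
by rewrite binary_value_cons Hw'; lia.
Qed.

Lemma encode_word_nseq m : encode_word (nseq m true) = rcons (nseq (2 * m) true) false.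
Proof.
rewrite /encode_word mul2n; congr rcons.
by elim: m => // m IHm; rewrite doubleS /= -IHm.
Qed.

(** A counter of value [v] yields [v.+1] words, as underflow is noticed only after a word has been
    emitted. The bound [P] for the head and the counter covers seeking and decrementing, and [m + v]
    is the same in all rounds, which makes the time per round uniform. *)
Lemma list_loop v c w j m o P :
    c.1 = inr LSeek -> counter_inv c w j m 0 o -> binary_value w = v ->
    j <= P -> size w <= P ->
  exists c', [/\ reaches (v.+1 * (2 * P + 4 * (m + v) + 10)) c c', list_step c' = None &
    exists i, tape_is (c'.2 output)
      (o ++ encode_list [seq nseq i true | i <- iota m v.+1]) i].
Proof.
elim: v c w j m o => [|v IHv] c w j m o E I Hw jP wP;
  have [c1 [r1 E1 I1]] := seek_phase E I;
  have [c2 [r2 E2 I2]] := emit_phase (leq0n m) E1 I1;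
  have [c3 [r3 E3 I3]] := back_phase (leqnn _) E2 I2;
  rewrite subn0 -encode_word_nseq in r2 I3.
  rewrite (binary_value0 Hw) in I3.
  have [c4 [r4 H4 T4]] := underflow_phase (j := 0) E3 I3.
  exists c4; split=> //; last by eexists; move: T4; rewrite /encode_list /= cats0; exact.
  apply: reaches_le (reaches_trans r1 (reaches_trans r2 (reaches_trans r3 r4))).
  lia.
have [a [w' [Ew Hw']]] := binary_valueS Hw.
rewrite Ew in I3; have [c4 [r4 E4 I4]] := decrement_phase (j := 0) E3 I3.
have sa : size w = a + (size w').+1 by rewrite Ew size_cat size_nseq.
have [||c5 [r5 H5 [l T5]]] := IHv c4 _ _ _ _ E4 I4 Hw'.
- by rewrite add0n; lia.
- by rewrite size_cat size_nseq /=; lia.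
exists c5; split=> //; last by exists l; move: T5; rewrite -catA.
apply: reaches_le (reaches_trans r1 (reaches_trans r2 (reaches_trans r3 (reaches_trans r4 r5)))).
have -> : v.+2 * (2 * P + 4 * (m + v.+1) + 10) =
  2 * P + 4 * (m + v.+1) + 10 + v.+1 * (2 * P + 4 * (m.+1 + v) + 10).
  by rewrite [LHS]mulSn addSnnS.
lia.
Qed.

(** * Preparing the unary input *)

Definition setup_inv c (w : word) (i : nat) (u : word) (j : nat) : Prop :=
  [/\ tape_is (c.2 (inl inn)) w i,
      forall t, t != inn -> tape_is (c.2 (inl t)) [::] 0,
      tape_is (c.2 mark) [:: false] (c.2 (inl out)).2,
      tape_is (c.2 unary) u j & tape_is (c.2 output) [::] 0].

Lemma head_act (v : cell N * option bool) (tc : tape_content N) :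
  (act v tc).2 = move v.2 tc.2.
Proof. by rewrite /act /=; case: v.2 => [[]|]. Qed.

Lemma mark_tape c q a u o :
  tape_is (c.2 mark) [:: false] (c.2 (inl out)).2 ->
  tape_is ((list_succ c (q, moves a u (scan c mark) o)).2 mark) [:: false]
    ((list_succ c (q, moves a u (scan c mark) o)).2 (inl out)).2.
Proof. by move=> T; rewrite /list_succ /= !ffunE head_act; exact: tape_is_keep _ T. Qed.

Lemma unary_phase c i y :
    c.1 = inr LUnary ->
    setup_inv c (nseq i true ++ y) i (false :: nseq i true) i.+1 ->
  let n := i + size y in
  exists c', [/\ reaches (size y).+1 c c', c'.1 = inr LRewind &
    setup_inv c' (nseq n true) n (false :: nseq n true) n.+1].
Proof.
elim: y c i => [|b y IHy] c i E [Ti To Tc Tu Tw].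
  rewrite cats0 in Ti; rewrite /= addn0.
  have sc : scan c (inl inn) = None.
    by rewrite ffunE (tape_is_scan Ti) size_nseq ltnn.
  set c1 := list_succ c (inr LRewind, moves (fun t => stay (scan c) (inl t))
    (stay (scan c) unary) (scan c mark) (stay (scan c) output)).
  have s1 : list_step c = Some c1 by rewrite /list_step E /= sc.
  exists c1; split=> //; first exact: reaches_step s1 (reaches_refl _ _).
  split; [|move=> t nt|exact: mark_tape| |]; rewrite /= !ffunE /stay /= ?ffunE.
  - exact: tape_is_keep None Ti.
  - exact: tape_is_keep None (To t nt).
  - exact: tape_is_keep None Tu.
  - exact: tape_is_keep None Tw.
have sc : scan c (inl inn) = Some (inl b).
  by rewrite ffunE (tape_is_scan Ti) size_cat size_nseq nth_nseq_cat /= -addSnnS leq_addr.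
set c1 := list_succ c (inr LUnary, moves (stay_but (scan c) inn (Some (inl true), Some true))
  (Some (inl true), Some true) (scan c mark) (stay (scan c) output)).
have s1 : list_step c = Some c1 by rewrite /list_step E /= sc.
have [|c' [r E' I']] := IHy c1 i.+1 erefl; last first.
  by exists c'; rewrite /= -addSnnS; split=> //; apply: reaches_step s1 r.
split; [|move=> t nt|exact: mark_tape| |];
  rewrite /= !ffunE /stay_but /stay ?eqxx /= ?ffunE.
- have := tape_is_write true (Some true) Ti.
  rewrite set_nth_nseq_cat -[nseq i true ++ true :: y]cat_rcons nseq_rcons.
  by apply; rewrite size_cat size_nseq leq_addr.
- by rewrite (negbTE nt); exact: tape_is_keep None (To t nt).
- have := tape_is_write true (Some true) Tu; rewrite /= size_nseq => /(_ (ltnSn _)).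
  by rewrite set_nth_nseq.
- exact: tape_is_keep None Tw.
Qed.

(** The input head is one cell behind the head of [unary], which sees the 0. At the last move the
    input head is already leftmost and stays there. *)
Lemma rewind_phase c w n j :
    c.1 = inr LRewind -> setup_inv c w j.-1 (false :: nseq n true) j -> j <= n.+1 ->
  exists c', [/\ reaches j.+1 c c', c'.1 = inl (start M) &
    setup_inv c' w 0 (false :: nseq n true) 0].
Proof.
elim: j c => [|j IHj] c E [Ti To Tc Tu Tw] jn.
  have sc : scan c unary = Some (inl false) by rewrite ffunE (tape_is_scan Tu).
  set c1 := list_succ c (inl (start M), moves (fun t => stay (scan c) (inl t))
    (stay (scan c) unary) (scan c mark) (stay (scan c) output)).
  have s1 : list_step c = Some c1 by rewrite /list_step E /= sc.
  exists c1; split=> //; first exact: reaches_step s1 (reaches_refl _ _).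
  split; [|move=> t nt|exact: mark_tape| |]; rewrite /= !ffunE /stay /= ?ffunE.
  - exact: tape_is_keep None Ti.
  - exact: tape_is_keep None (To t nt).
  - exact: tape_is_keep None Tu.
  - exact: tape_is_keep None Tw.
have sc : (scan c unary == Some (inl false)) = false.
  by rewrite ffunE (tape_is_scan Tu) /= size_nseq nth_nseq ltnS; case: ltnP.
set c1 := list_succ c (inr LRewind,
  moves (stay_but (scan c) inn (scan c (inl inn), Some false))
  (scan c unary, Some false) (scan c mark) (stay (scan c) output)).
have s1 : list_step c = Some c1 by rewrite /list_step /c1 E /= sc.
have [||c' [r E' I']] := IHj c1 erefl; [|lia|]; last first.
  by exists c'; split=> //; apply: reaches_step s1 r.
split; [|move=> t nt|exact: mark_tape| |];
  rewrite /= !ffunE /stay_but /stay ?eqxx /= ?ffunE.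
- exact: tape_is_keep (Some false) Ti.
- by rewrite (negbTE nt); exact: tape_is_keep None (To t nt).
- exact: tape_is_keep (Some false) Tu.
- exact: tape_is_keep None Tw.
Qed.

(** * Simulation of the machine that computes the bound *)

Definition simulates (n : nat) (c : config M) (c' : config N) : Prop :=
  [/\ c'.1 = inl c.1,
      forall t, (forall j, nth None (c'.2 (inl t)).1 j = nth None (c.2 t).1 j) /\
        (c'.2 (inl t)).2 = (c.2 t).2,
      tape_is (c'.2 mark) [:: false] (c'.2 (inl out)).2,
      tape_is (c'.2 unary) (false :: nseq n true) 0 & tape_is (c'.2 output) [::] 0].

Lemma simulates_init n c' : c'.1 = inl (start M) ->
  setup_inv c' (nseq n true) 0 (false :: nseq n true) 0 ->
  simulates n (init M (nseq n true)) c'.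
Proof.
move=> E [Ti To Tc Tu Tw]; split=> // t; rewrite ffunE /= -/inn.
case: eqVneq => [->|/To] /=; first by case: Ti.
by case.
Qed.

Lemma simulates_scan n (c : config M) c' : simulates n c c' ->
  [ffun t => scan c' (inl t)] = scan c.
Proof. by case=> _ H _ _ _; apply/ffunP=> t; rewrite !ffunE (H t).2 (H t).1. Qed.

Lemma simulates_step O n (c c1 : config M) c' : deterministic M ->
  step O c c1 -> simulates n c c' ->
  exists2 c1', list_step c' = Some c1' & simulates n c1 c1'.
Proof.
move=> D s Sim; have [E H Tc Tu Tw] := Sim.
move: s; rewrite /step; case: (query c.1) => [[]|] /existsP[a /andP[Ha /eqP ->]].
exists (list_succ c' (inl a.1, moves a.2 (stay (scan c') unary) (scan c' mark)
    (stay (scan c') output))).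
  rewrite /list_step E /= (simulates_scan Sim); case: pickP => [b Hb|/(_ a)].
    by have /card_le1_eqP Dab := D c.1 (scan c); rewrite (Dab a b).
  by rewrite Ha.
split=> //; [move=> t|exact: mark_tape| |]; rewrite /= !ffunE /stay /= ?ffunE.
- have [H1 H2] := H t; rewrite H2; split=> [j|] //.
  by rewrite !nth_set_nth /= H1.
- exact: tape_is_keep None Tu.
- exact: tape_is_keep None Tw.
Qed.

Lemma simulates_path O n (c : config M) c' p : deterministic M ->
  path (step O) c p -> simulates n c c' ->
  exists2 c1', reaches (size p) c' c1' & simulates n (last c p) c1'.
Proof.
move=> D; elim: p c c' => [|c1 p IHp] c c' /=; first by exists c' => //; exact: reaches_refl.
case/andP=> s Hp Sim; have [c1' s1 Sim1] := simulates_step D s Sim.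
by have [c2' r2 Sim2] := IHp _ _ Hp Sim1; exists c2' => //; apply: reaches_step s1 r2.
Qed.

Lemma simulates_halted n (c : config M) c' : halted c -> simulates n c c' ->
  exists c1', [/\ list_step c' = Some c1', c1'.1 = inr LSeek &
    counter_inv c1' (tape_word c out) (c.2 out).2 n 0 [::]].
Proof.
case/andP=> _ h Sim; have [E H Tc Tu Tw] := Sim.
exists (list_succ c' (inr LSeek, moves (fun t => stay (scan c') (inl t))
  (stay (scan c') unary) (scan c' mark) (stay (scan c') output))); split=> //.
  rewrite /list_step E /= (simulates_scan Sim); case: pickP => // a.
  by move: h; rewrite cards_eq0 => /eqP ->; rewrite inE.
have [Hn Hh] := H out.
split; rewrite /= !ffunE /stay /= ?ffunE.
- by rewrite bits_of_keep; exact: bits_of_nth.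
- by [].
- by rewrite -Hh; exact: tape_is_keep None Tc.
- exact: tape_is_keep None Tu.
- exact: tape_is_keep None Tw.
Qed.

Lemma setup_start x : exists c, [/\ list_step (init N x) = Some c, c.1 = inr LUnary &
  setup_inv c x 0 [:: false] 1].
Proof.
set c0 := init N x.
have T0 t : tape_is (c0.2 t) (if t == inl inn then x else [::]) 0.
  by rewrite /= ffunE /=; case: ifP.
exists (list_succ c0 (inr LUnary, moves (fun t => stay (scan c0) (inl t))
  (Some (inl false), Some true) (Some (inl false)) (stay (scan c0) output))); split=> //.
have act0 t b d : t != inl inn ->
    tape_is (@act void N (Some (inl b), d) (c0.2 t)) [:: b] (move d 0).
  by move=> nt; have := T0 t; rewrite (negbTE nt) => /tape_is_write; apply.
have keep0 t : tape_is (@act void N (nth None (c0.2 t).1 (c0.2 t).2, None) (c0.2 t))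
    (if t == inl inn then x else [::]) 0 by exact: tape_is_keep None (T0 t).
have E t : (list_succ c0 (inr LUnary, moves (fun t => stay (scan c0) (inl t))
  (Some (inl false), Some true) (Some (inl false)) (stay (scan c0) output))).2 t =
  @act void N (match t with
    | inr None => (Some (inl false), Some true)
    | inr (Some false) => (Some (inl false), None)
    | _ => (nth None (c0.2 t).1 (c0.2 t).2, None) end) (c0.2 t).
  rewrite [LHS]ffunE [in LHS]ffunE.
  have S t' : scan c0 t' = nth None (c0.2 t').1 (c0.2 t').2 by rewrite ffunE.
  by case: t => [t|[[]|]]; rewrite // -S.
split=> [|t nt|||]; rewrite !E.
- by have := keep0 (inl inn); rewrite eqxx.
- by have := keep0 (inl t); rewrite (inj_eq inl_inj) (negbTE nt).
- by rewrite head_act (T0 (inl out)).2; exact: (act0 mark false None).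
- exact: (act0 unary false (Some true)).
- exact: keep0 output.
Qed.

Lemma list_machine_run e x : deterministic M -> polytime_exp M e ->
    (* [P] below is input length plus time bound of [M]; it dominates the output word and the head
       position with which the loop begins. *)
    (exists p : seq (config M),
       computation (of_void language) (nseq (size x) true) p /\
       halted (last (init M (nseq (size x) true)) p)) ->
  let n := size x in let P := n + (n ^ e + e) in
  exists p0 : seq (config M), halted (last (init M (nseq n true)) p0) /\
    computation (of_void language) (nseq n true) p0 /\
    let k := binary_value (tape_word (last (init M (nseq n true)) p0) out) in
    exists c', [/\ reaches (2 * n + P + 6 + k.+1 * (2 * P + 4 * (n + k) + 10)) (init N x) c',
      list_step c' = None &
      tape_word c' output = encode_list [seq nseq i true | i <- iota n k.+1]].
Proof.
move=> D Pe [p [Hp hp]] n P; exists p; split=> //; split=> // k.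
have [c1 [s1 E1 I1]] := setup_start x.
have [c2 [r2 E2 I2]] := @unary_phase c1 0 x E1 I1; rewrite add0n in I2.
have [c3 [r3 E3 I3]] := @rewind_phase c2 _ (size x) (size x).+1 E2 I2 (leqnn _).
have [c4 r4 S4] := simulates_path D Hp (simulates_init E3 I3).
have [c5 [s5 E5 I5]] := simulates_halted hp S4.
have sp : size p <= n ^ e + e by have := Pe _ _ _ Hp; rewrite size_nseq.
have [g1 g2] := computation_growth out Hp; rewrite size_nseq in g2.
have [||c6 [r6 H6 [l T6]]] := list_loop (P := P) E5 I5 erefl.
- by rewrite /P; lia.
- by apply: leq_trans (size_bits_of _) _; rewrite /P; lia.
exists c6; split=> //; last exact: tape_is_bits T6.
apply: reaches_le (reaches_step s1 (reaches_trans r2 (reaches_trans r3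
  (reaches_trans r4 (reaches_step s5 r6))))).
by rewrite -/k -/n /P; lia.
Qed.

End ListMachine.

Lemma list_of_lengths_computable (k : nat -> nat) :
  polytime_bound k -> poly_bounded k ->
  polytime_computable
    (encode_list \o fun x : word => [seq nseq i true | i <- iota (size x) (k (size x)).+1]).
Proof.
case=> f [M [D [e Pe] Hf]] Hk k_poly.
have run x : exists2 c', reaches (2 * size x + (size x + (size x ^ e + e)) + 6 +
      (k (size x)).+1 * (2 * (size x + (size x ^ e + e)) + 4 * (size x + k (size x)) + 10))
      (init (list_machine M) x) c' &
    list_step c' = None /\ tape_word c' (output M) =
      encode_list [seq nseq i true | i <- iota (size x) (k (size x)).+1].
  have [q [Hq hq wq]] := Hf (nseq (size x) true).
  have [|p [hp [Hp [c' [r H T]]]]] := @list_machine_run M e x D Pe; first by exists q.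
  have Epq : p = q.
    have [s Es] := deterministic_prefix D Hp Hq hq.
    case: s Es => [|c s] Es; first by rewrite Es cats0.
    move: Hq; rewrite Es /computation cat_path => /andP[_ /andP[st _]].
    by case/negP: (halted_no_step (of_void language) c hp).
  have Ek : binary_value (tape_word (last (init M (nseq (size x) true)) p) (out_tape M)) =
      k (size x) by rewrite Epq wq Hk.
  by rewrite Ek in r T; exists c'.
exists (list_machine M); split; first exact: list_machine_deterministic.
- have /poly_boundedE[E HE] : poly_bounded (fun n => 2 * n + (n + (n ^ e + e)) + 6 +
      (k n).+1 * (2 * (n + (n ^ e + e)) + 4 * (n + k n) + 10)).
    have PP : poly_bounded (fun n => n + (n ^ e + e)).
      apply: poly_bounded_add poly_bounded_id _.
      exact: poly_bounded_add (poly_bounded_exp e) (poly_bounded_const e).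
    have c2 := poly_bounded_const 2; have c4 := poly_bounded_const 4.
    apply: poly_bounded_add.
      apply: poly_bounded_add (poly_bounded_const 6).
      exact: poly_bounded_add (poly_bounded_mul c2 poly_bounded_id) PP.
    apply: poly_bounded_mul.
      apply: (@poly_bounded_le _ (fun n => k n + 1)) => [n|]; first by rewrite addn1.
      exact: poly_bounded_add k_poly (poly_bounded_const 1).
    apply: poly_bounded_add (poly_bounded_const 10).
    apply: poly_bounded_add (poly_bounded_mul c2 PP) _.
    exact: poly_bounded_mul c4 (poly_bounded_add poly_bounded_id k_poly).
  exists E => O x p Hp; apply: leq_trans (HE (size x)).
  have [c' [m mn r] [H _]] := run x.
  have [q [sq Hq lq]] := runs_path O r.
  have [|s Es] := deterministic_prefix (@list_machine_deterministic M) Hp Hq.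
    by rewrite lq list_halted H.
  by apply: leq_trans mn; rewrite -sq Es size_cat leq_addr.
- move=> x; have [c' [m mn r] [H T]] := run x.
  have [q [sq Hq lq]] := runs_path (of_void language) r.
  by exists q; rewrite lq list_halted H eqxx; split.
Qed.

(** The list reduction applied to any [D] that recognizes nonempty blocks decides [hit] on [1^n].
    Keeping [C] and [D] abstract lets both separations share one oracle. *)
Lemma not_turing_reducible k h B (C : set language) D :
    polytime_bound k -> poly_bounded k -> promise h B ->
    (forall L, turing_reducible k (oracle h B) (USigma h (oracle h B)) L ->
       exists2 n, 0 < n & ~ (L (nseq n true) <-> hit k B n)) ->
    C D -> (forall m, 0 < m -> nseq m true \in D <-> 0 < size (block h B m)) ->
  ~ (dtt_reducible (fun n => k n + 1) C `<=`
     turing_reducible k (oracle h B) (USigma h (oracle h B))).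
Proof.
move=> kP k_poly pB HB CD HD sub.
pose f (x : word) := [seq nseq i true | i <- iota (size x) (k (size x)).+1].
have [|n n0] := HB [set x | exists2 y, y \in f x & D y].
  apply: sub; exists D => //; exists f; split=> //.
  - exact: list_of_lengths_computable.
  - by move=> x; rewrite size_map size_iota addn1.
apply=> /=; split=> [[y /mapP[m]]|[[m z] Bz /= mn]].
  rewrite mem_iota size_nseq => mn -> /mem_set.
  have m0 : 0 < m by lia.
  move/(HD m m0); case Eb: (block h B m) => [//|z s] _.
  exists (m, z); last by move=> /=; lia.
  by apply/(mem_block pB); rewrite Eb mem_head.
exists (nseq m true); first by apply/mapP; exists m; rewrite ?mem_iota ?size_nseq //; lia.
have m0 : 0 < m by lia.
apply/set_mem/(HD m m0); have /(mem_block pB) := Bz.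
by case: (block h B m).
Qed.

Theorem theorem4p7 (k : nat -> nat) (k_poly : polytime_bound k)
    (k_bounded : polynomially_bounded k) (h : nat) (h_ge1 : 1 <= h) :
  exists A : language,
    ~ (dtt_reducible (fun n => k n + 1) (UP_le h A) `<=`
       turing_reducible k A (USigma h A)) /\
    ~ (dtt_reducible (fun n => k n + 1) (USigma h A) `<=`
       turing_reducible k A (USigma h A)).
Proof.
have k_pb : poly_bounded k by apply/poly_boundedE.
have [B pB HB] := generic_oracle h_ge1 k_pb.
exists (oracle h B); split.
  apply: (not_turing_reducible k_poly k_pb pB HB (nonempty_block_UP pB)) => m m0.
  exact: nonempty_blockP.
(* Instead of comparing the two classes, the same reduction is run on a second language with the
   same values on [1^m]. *)
apply: (not_turing_reducible k_poly k_pb pB HB (counted_block_USigma pB)) => m m0.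
exact: counted_blockP.
Qed.
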